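(* Let $R$ be a commutative Noetherian ring with non-zero identity, $\mathfrak a$ an ideal of $R$, $M$ a finitely generated $R$-module, $X$ an arbitrary $R$-module and $n$ a non-negative integer such that $\operatorname{Ext}^{n-i}_R(M,H^i_{\mathfrak a}(X))$ is of finite length for all $i\le n$. Then: (a) $H^n_{\mathfrak a}(M,X)$ is of finite length, and (b) $l_R(H^n_{\mathfrak a}(M,X))\le\displaystyle\sum_{i=0}^{n}l_R\big(\operatorname{Ext}^{n-i}_R(M,H^i_{\mathfrak a}(X))\big)$.
   Context: $H^i_{\mathfrak a}(M,X)=\varinjlim_{k}\operatorname{Ext}^i_R(M/\mathfrak a^kM,X)$ is the $i$-th generalized local cohomology module, and $H^i_{\mathfrak a}(X)=H^i_{\mathfrak a}(R,X)$ is ordinary local cohomology. $l_R$ denotes length. *)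

(* Defs.v *)
From HB Require Import structures.
From mathcomp Require Import all_boot all_algebra all_classical.
From mathcomp Require Import freeg.

Set Implicit Arguments.
Unset Strict Implicit.
Unset Printing Implicit Defensive.

Import GRing.Theory.
Local Open Scope ring_scope.
Local Open Scope quotient_scope.

(* Submodules of V are MathComp's [submodClosed V]: predicates V -> bool closed
   under the module operations; undecidable conditions are made boolean
   classically by `[< _ >]. An ideal of R is a submodule of R^o ([idealr] is
   not used because it excludes the unit ideal). *)

Section Submodules.
Variables (R : comNzRingType).
Implicit Types V W : lmodType R.

Lemma subsemimodP V (S : {pred V}) :
  0 \in S -> (forall (a : R) u v, u \in S -> v \in S -> a *: u + v \in S) ->
  GRing.subsemimod_closed S.
Proof. by move=> S0 Sl; apply: GRing.submod_closed_semi; split. Qed.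

Definition full_pred V : V -> bool := fun=> true.
Fact full_closed V : GRing.subsemimod_closed (@full_pred V).
Proof. exact: subsemimodP. Qed.
HB.instance Definition _ V :=
  GRing.isSubmodClosed.Build R V (@full_pred V) (@full_closed V).
Definition full V : submodClosed V := (@full_pred V : {pred V}).

Definition span_pred V (A : set V) : V -> bool := fun v =>
  `[< forall S : submodClosed V, (forall x, A x -> x \in S) -> v \in S >].
Fact span_closed V (A : set V) : GRing.subsemimod_closed (span_pred A).
Proof.
apply: subsemimodP => [|a u v /asboolP Au /asboolP Av]; apply/asboolP => S AS.
  exact: rpred0.
by apply: rpredD; [apply: rpredZ; apply: Au | apply: Av].
Qed.
HB.instance Definition _ V (A : set V) :=
  GRing.isSubmodClosed.Build R V (span_pred A) (span_closed A).
Definition span V (A : set V) : submodClosed V := (span_pred A : {pred V}).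

Definition ker_pred V W (f : {linear V -> W}) : V -> bool := fun v => f v == 0.
Fact ker_closed V W (f : {linear V -> W}) :
  GRing.subsemimod_closed (ker_pred f).
Proof.
apply: subsemimodP => [|a u v]; rewrite !unfold_in ?linear0//.
by move=> /eqP fu /eqP fv; rewrite linearP fu fv scaler0 addr0.
Qed.
HB.instance Definition _ V W (f : {linear V -> W}) :=
  GRing.isSubmodClosed.Build R V (ker_pred f) (ker_closed f).
Definition ker V W (f : {linear V -> W}) : submodClosed V :=
  (ker_pred f : {pred V}).

End Submodules.

Section SubType.
Variables (R : comNzRingType) (V : lmodType R) (S : submodClosed V).

Record subm := Subm { subm_val :> V; _ : subm_val \in (S : {pred V}) }.

HB.instance Definition _ := [isSub for subm_val].
HB.instance Definition _ := [Choice of subm by <:].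
HB.instance Definition _ := [SubChoice_isSubLmodule of subm by <:].

Fact subm_val_linear : linear subm_val. Proof. by []. Qed.
HB.instance Definition _ :=
  GRing.isLinear.Build R subm V _ subm_val subm_val_linear.

End SubType.

Section QuotientModule.
Variables (R : comNzRingType) (V : lmodType R) (S : submodClosed V).

(* [Quotient.quot] takes a [zmodClosed] predicate, and [submodClosed] does not
   inherit from it. *)
Definition zmod_pred : V -> bool := fun v => v \in S.
Fact zmod_pred_closed : zmod_closed zmod_pred.
Proof. exact/GRing.subsemimod_closedB/GRing.subsemimodClosedP. Qed.
HB.instance Definition _ :=
  GRing.isZmodClosed.Build V zmod_pred zmod_pred_closed.

Definition quotm := @Quotient.quot V (zmod_pred : {pred V}).
HB.instance Definition _ := GRing.Zmodule.on quotm.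
HB.instance Definition _ := Quotient.on quotm.

Definition quotm_pi (v : V) : quotm := \pi_quotm v.

Lemma quotm_reprK (q : quotm) : quotm_pi (repr q) = q.
Proof. exact: reprK. Qed.

Lemma quotm_eqE (u v : V) : (quotm_pi u == quotm_pi v) = (u - v \in S).
Proof. by rewrite /quotm_pi -[LHS]Quotient.idealrBE. Qed.

Fact quotm_piD (u v : V) : quotm_pi (u + v) = quotm_pi u + quotm_pi v.
Proof. by rewrite /quotm_pi [RHS]piE. Qed.

Definition quotm_scale (a : R) (q : quotm) : quotm := quotm_pi (a *: repr q).

Fact quotm_scaleE a v : quotm_scale a (quotm_pi v) = quotm_pi (a *: v).
Proof.
apply/eqP; rewrite quotm_eqE -scalerBr; apply: rpredZ.
by rewrite -quotm_eqE quotm_reprK.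
Qed.
Fact quotm_scaleA a b q :
  quotm_scale a (quotm_scale b q) = quotm_scale (a * b) q.
Proof. by rewrite -[q]quotm_reprK !quotm_scaleE scalerA. Qed.
Fact quotm_scale1 : left_id 1 quotm_scale.
Proof. by move=> q; rewrite -[q]quotm_reprK quotm_scaleE scale1r. Qed.
Fact quotm_scaleDr : right_distributive quotm_scale +%R.
Proof.
move=> a p q; rewrite -[p]quotm_reprK -[q]quotm_reprK -quotm_piD !quotm_scaleE.
by rewrite scalerDr quotm_piD.
Qed.
Fact quotm_scaleDl q : {morph quotm_scale^~ q : a b / a + b}.
Proof.
by move=> a b; rewrite -[q]quotm_reprK !quotm_scaleE -quotm_piD scalerDl.
Qed.
HB.instance Definition _ := GRing.Zmodule_isLmodule.Build R quotm
  quotm_scaleA quotm_scale1 quotm_scaleDr quotm_scaleDl.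

Fact quotm_pi_linear : linear quotm_pi.
Proof. by move=> a u v; rewrite quotm_piD -quotm_scaleE. Qed.
HB.instance Definition _ :=
  GRing.isLinear.Build R V quotm _ quotm_pi quotm_pi_linear.

End QuotientModule.

Section QuotientMap.
Variables (R : comNzRingType) (V : lmodType R) (S T : submodClosed V).
Hypothesis sST : {subset S <= T}.

Definition quotm_proj (q : quotm S) : quotm T := quotm_pi T (repr q).

Lemma quotm_projE v : quotm_proj (quotm_pi S v) = quotm_pi T v.
Proof. by apply/eqP; rewrite quotm_eqE sST// -quotm_eqE quotm_reprK. Qed.

Fact quotm_proj_linear : linear quotm_proj.
Proof.
move=> a p q; rewrite -[p]quotm_reprK -[q]quotm_reprK -linearP.
by rewrite !quotm_projE linearP.
Qed.
HB.instance Definition _ :=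
  GRing.isLinear.Build R (quotm S) (quotm T) _ quotm_proj quotm_proj_linear.

Definition quotm_projL : {linear quotm S -> quotm T} := quotm_proj.

End QuotientMap.

(* The module S / T for submodules S and T of V; it is only used for T
   contained in S (in general it is S / (S `&` T)). *)
Section SubQuotient.
Variables (R : comNzRingType) (V : lmodType R) (S T : submodClosed V).

Definition trace_pred : subm S -> bool := fun x => subm_val x \in T.
Fact trace_closed : GRing.subsemimod_closed trace_pred.
Proof.
apply: subsemimodP => [|a u v Tu Tv]; first exact: rpred0.
by apply: rpredD => //; apply: rpredZ.
Qed.
HB.instance Definition _ :=
  GRing.isSubmodClosed.Build R (subm S) trace_pred trace_closed.

Definition trace : submodClosed (subm S) := (trace_pred : {pred subm S}).

Definition subquot : lmodType R := quotm trace.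
Definition subquot_pi (x : subm S) : subquot := quotm_pi trace x.
Definition subquot_repr (q : subquot) : subm S := repr (q : quotm trace).

End SubQuotient.

Section Finiteness.
Variable R : comNzRingType.
Implicit Type V : lmodType R.

Definition finitely_generated V :=
  exists s : seq V, span [set` s]%classic =i full V.

Definition noetherian :=
  forall I : submodClosed R^o, exists s : seq R^o, span [set` s]%classic =i I.

Definition ideal_mul V (a : submodClosed R^o) (S : submodClosed V) :
    submodClosed V :=
  span [set x : V |
    exists r m, [/\ r \in (a : {pred R^o}), m \in S & x = (r : R) *: m]].

Definition ideal_exp (a : submodClosed R^o) (k : nat) : submodClosed R^o :=
  iter k (ideal_mul a) (full R^o).

Definition powmod (a : submodClosed R^o) V (k : nat) : submodClosed V :=
  ideal_mul (ideal_exp a k) (full V).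

Definition has_chain V (n : nat) :=
  exists S : nat -> submodClosed V, forall i, (i < n)%N ->
    {subset S i <= S i.+1} /\ exists2 x, x \in S i.+1 & x \notin S i.

Definition finite_length V := exists n, forall m, has_chain V m -> (m <= n)%N.

(* The largest length of a strict chain of submodules of V, with the junk
   value 0 when V is not of finite length. *)
Definition mod_length V : nat :=
  xget 0%N [set n | has_chain V n /\
                    forall m, has_chain V m -> (m <= n)%N]%classic.

Lemma ideal_expS_sub a k : {subset ideal_exp a k.+1 <= ideal_exp a k}.
Proof.
elim: k => [|k IHk] x; first by [].
move=> /asboolP; apply=> y [r [m [ra mk ->]]].
by apply/asboolP => S; apply; exists r, m; split=> //; apply: IHk.
Qed.

Lemma powmodS_sub a V k : {subset powmod a V k.+1 <= powmod a V k}.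
Proof.
move=> x /asboolP; apply=> y [r [m [ra mk ->]]].
apply/asboolP => S; apply; exists r, m; split=> //.
exact: ideal_expS_sub.
Qed.

End Finiteness.

(* F(V) is the free module on the underlying set of V. The resolution of M is
     ... -> F(syz M 2) -> F(syz M 1) -> F(syz M 0) -> M -> 0
   where syz M 0 = M and syz M i.+1 is the kernel of the canonical surjection
   F(syz M i) -> syz M i. *)

Section FreeModule.
Variable R : comNzRingType.
Implicit Types V W : lmodType R.

Definition freem V : lmodType R := {freeg V / R}.

Section Lift.
Variables (V W : lmodType R) (f : V -> W).
Definition free_lift (D : freem V) : W := fglift f D.
Fact free_lift_linear : linear free_lift.
Proof.
move=> a D E; rewrite /free_lift.
have fgB D1 D2 : fglift f (D1 - D2) = fglift f D1 - fglift f D2.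
  exact: lift_is_additive.
have fg0 : fglift f 0 = 0 by rewrite -(subrr (0 : freem V)) fgB subrr.
have fgD D1 D2 : fglift f (D1 + D2) = fglift f D1 + fglift f D2.
  by rewrite -{1}[D2]opprK fgB -(sub0r D2) fgB fg0 sub0r opprK.
have fgsum s (F : V -> freem V) :
    fglift f (\sum_(x <- s) F x) = \sum_(x <- s) fglift f (F x).
  by elim/big_ind2: _ => // x1 x2 y1 y2 <- <-.
have -> : fglift f D = \sum_(x <- dom D) coeff x D *: f x.
  rewrite -{1}[D]freeg_sumE fgsum.
  by apply: eq_bigr => x _; rewrite liftU.
rewrite fgD; congr (_ + _).
rewrite [a *: D]/(fgscale a D) /fgscale fgsum scaler_sumr.
by apply: eq_bigr => x _; rewrite liftU scalerA.
Qed.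
HB.instance Definition _ :=
  GRing.isLinear.Build R (freem V) W _ free_lift free_lift_linear.
Definition free_liftL : {linear freem V -> W} := free_lift.

Lemma free_liftU v : free_lift << v >> = f v.
Proof. by rewrite /free_lift liftU scale1r. Qed.
End Lift.

Lemma free_ext V W (f g : {linear freem V -> W}) :
  (forall v, f << v >> = g << v >>) -> f =1 g.
Proof.
move=> fg D; rewrite -[D]freeg_sumE !linear_sum; apply: eq_bigr => x _.
have -> : << coeff x D *g x >> = coeff x D *: (<< x >> : freem V).
  apply/eqP/freeg_eqP => y.
  by rewrite coeffZ !coeffU mul1r.
by rewrite !linearZ/= fg.
Qed.

Definition aug V : {linear freem V -> V} := free_liftL id.

Definition free_map V W (f : V -> W) : {linear freem V -> freem W} :=
  free_liftL (fun v => << f v >>).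

Lemma aug_map V W (f : {linear V -> W}) D : aug W (free_map f D) = f (aug V D).
Proof.
by apply: (@free_ext V W (aug W \o free_map f) (f \o aug V)) => v /=;
  rewrite !free_liftU.
Qed.

Fixpoint syz V (i : nat) : lmodType R :=
  if i is j.+1 then subm (ker (aug (syz V j))) else V.

Definition res V (i : nat) : lmodType R := freem (syz V i).

Definition res_diff V (i : nat) : {linear res V i.+1 -> res V i} :=
  @subm_val _ _ (ker (aug (syz V i))) \o aug (syz V i.+1).

Section SyzMap.
Variables (V W : lmodType R) (f : {linear V -> W}).

Fact ker_map_subproof (x : subm (ker (aug V))) :
  free_map f (subm_val x) \in (ker (aug W) : {pred _}).
Proof.
case: x => x /=; rewrite !unfold_in /ker_pred => /eqP x0.
by rewrite aug_map x0 linear0.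
Qed.
Definition ker_map (x : subm (ker (aug V))) : subm (ker (aug W)) :=
  Subm (ker_map_subproof x).
Fact ker_map_linear : linear ker_map.
Proof. by move=> a x y; apply: val_inj; rewrite /= !linearP. Qed.
HB.instance Definition _ := GRing.isLinear.Build R
  (subm (ker (aug V))) (subm (ker (aug W))) _ ker_map ker_map_linear.
Definition ker_mapL : {linear subm (ker (aug V)) -> subm (ker (aug W))} :=
  ker_map.
End SyzMap.

Fixpoint syz_map V W (f : {linear V -> W}) i : {linear syz V i -> syz W i} :=
  if i is j.+1 then ker_mapL (syz_map f j) else f.

Definition res_map V W (f : {linear V -> W}) i : {linear res V i -> res W i} :=
  free_map (syz_map f i).

Lemma res_map_diff V W (f : {linear V -> W}) i x :
  res_map f i (res_diff V i x) = res_diff W i (res_map f i.+1 x).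
Proof. by rewrite /res_diff /= aug_map. Qed.

Lemma res_diffK V i x : res_diff V i (res_diff V i.+1 x) = 0.
Proof.
rewrite /res_diff /=; case: (aug _ x) => y /=.
by rewrite unfold_in /ker_pred => /eqP ->.
Qed.

End FreeModule.

Section Ext.
Variable R : comNzRingType.
Implicit Types M N X : lmodType R.

Definition cocycle_pred M X i : (res M i -> X) -> bool := fun f =>
  `[< linear f /\ forall y, f (res_diff M i y) = 0 >].
Fact cocycle_closed M X i : GRing.subsemimod_closed (@cocycle_pred M X i).
Proof.
apply: subsemimodP => [|a f g /asboolP[fl f0] /asboolP[gl g0]]; apply/asboolP.
  by split=> // b x y; rewrite scaler0 addr0.
split=> [b x y|y] /=; rewrite addrfctE scalrfctE /=.
  by rewrite fl gl !scalerDr !scalerA mulrC addrACA.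
by rewrite f0 g0 scaler0 addr0.
Qed.
HB.instance Definition _ M X i := GRing.isSubmodClosed.Build R
  (res M i -> X) (@cocycle_pred M X i) (@cocycle_closed M X i).
Definition cocycle M X i : submodClosed (res M i -> X) :=
  (@cocycle_pred M X i : {pred _}).

Definition coboundary_pred M X i : (res M i -> X) -> bool :=
  if i is j.+1 then
    fun f => `[< exists g : {linear res M j -> X}, f = g \o res_diff M j >]
  else fun f => f == 0.
Fact coboundary_closed M X i :
  GRing.subsemimod_closed (@coboundary_pred M X i).
Proof.
case: i => [|i]; apply: subsemimodP.
- by rewrite unfold_in.
- move=> a f g; rewrite !unfold_in => /eqP -> /eqP ->.
  by rewrite scaler0 addr0.
- by apply/asboolP; exists (\0 : {linear _ -> _}).
- move=> a _ _ /asboolP[f ->] /asboolP[g ->]; apply/asboolP.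
  by exists ((a \*: f) \+ g : {linear _ -> _}).
Qed.
HB.instance Definition _ M X i := GRing.isSubmodClosed.Build R
  (res M i -> X) (@coboundary_pred M X i) (@coboundary_closed M X i).
Definition coboundary M X i : submodClosed (res M i -> X) :=
  (@coboundary_pred M X i : {pred _}).

Definition Ext (i : nat) M X : lmodType R :=
  subquot (cocycle M X i) (coboundary M X i).

Section ExtMap.
Variables (M N X : lmodType R) (f : {linear M -> N}) (i : nat).

Fact cocycle_map_subproof (c : subm (cocycle N X i)) :
  subm_val c \o res_map f i \in (cocycle M X i : {pred _}).
Proof.
case: c => c /= /asboolP[cl c0]; apply/asboolP; split=> [a x y|y] /=.
  by rewrite linearP cl.
by rewrite res_map_diff c0.
Qed.
Definition cocycle_map (c : subm (cocycle N X i)) : subm (cocycle M X i) :=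
  Subm (cocycle_map_subproof c).

(* The class of a cocycle c is sent to the class of c \o res_map f i: the choice
   of representative made here is irrelevant by [Ext_mapE]. *)
Definition Ext_map (e : Ext i N X) : Ext i M X :=
  subquot_pi _ (cocycle_map (subquot_repr e)).

Lemma coboundary_map (h : res N i -> X) :
  h \in (coboundary N X i : {pred _}) ->
  h \o res_map f i \in (coboundary M X i : {pred _}).
Proof.
case: (i) h => [|j] h; first by move=> /eqP ->; apply/eqP/funext.
move=> /asboolP[g ->]; apply/asboolP.
exists (g \o res_map f j : {linear _ -> _}); apply/funext => x.
rewrite -[LHS]/(g (res_diff N j (res_map f j.+1 x))).
by rewrite -(@res_map_diff R M N f j x).
Qed.

Lemma Ext_mapE c :
  Ext_map (subquot_pi _ c) = subquot_pi _ (cocycle_map c).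
Proof.
have: subquot_repr (subquot_pi (coboundary N X i) c) - c \in
      (trace (cocycle N X i) (coboundary N X i) : {pred _}).
  by rewrite -quotm_eqE quotm_reprK.
by move=> /coboundary_map bc; apply/eqP; rewrite quotm_eqE.
Qed.

End ExtMap.
End Ext.

Section DirectSum.
Variables (R : comNzRingType) (E : nat -> lmodType R).

Definition dprod := forall k, E k.
HB.instance Definition _ := Choice.on dprod.

Lemma dprod_ext (s t : dprod) : (forall k, s k = t k) -> s = t.
Proof. exact: functional_extensionality_dep. Qed.

Definition dprod_add (s t : dprod) : dprod := fun k => s k + t k.
Definition dprod_opp (s : dprod) : dprod := fun k => - s k.
Definition dprod_scale (a : R) (s : dprod) : dprod := fun k => a *: s k.
Fact dprod_addA : associative dprod_add.
Proof. by move=> s t u; apply: dprod_ext => k; apply: addrA. Qed.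
Fact dprod_addC : commutative dprod_add.
Proof. by move=> s t; apply: dprod_ext => k; apply: addrC. Qed.
Fact dprod_add0 : left_id (fun k => 0 : E k) dprod_add.
Proof. by move=> s; apply: dprod_ext => k; apply: add0r. Qed.
Fact dprod_addN : left_inverse (fun k => 0 : E k) dprod_opp dprod_add.
Proof. by move=> s; apply: dprod_ext => k; apply: addNr. Qed.
HB.instance Definition _ :=
  GRing.isZmodule.Build dprod dprod_addA dprod_addC dprod_add0 dprod_addN.
Fact dprod_scaleA a b s :
  dprod_scale a (dprod_scale b s) = dprod_scale (a * b) s.
Proof. by apply: dprod_ext => k; apply: scalerA. Qed.
Fact dprod_scale1 : left_id 1 dprod_scale.
Proof. by move=> s; apply: dprod_ext => k; apply: scale1r. Qed.
Fact dprod_scaleDr : right_distributive dprod_scale +%R.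
Proof. by move=> a s t; apply: dprod_ext => k; apply: scalerDr. Qed.
Fact dprod_scaleDl s : {morph dprod_scale^~ s : a b / a + b}.
Proof. by move=> a b; apply: dprod_ext => k; apply: scalerDl. Qed.
HB.instance Definition _ := GRing.Zmodule_isLmodule.Build R dprod
  dprod_scaleA dprod_scale1 dprod_scaleDr dprod_scaleDl.

Definition dinj (k : nat) (x : E k) : dprod :=
  @dfwith nat (fun j => E j) (fun=> 0) k x.

Definition dsum : submodClosed dprod :=
  span [set s : dprod | exists k (x : E k), s = dinj x]%classic.

Definition dirlim (f : forall k, E k -> E k.+1) : lmodType R :=
  subquot dsum
    (span [set s : dprod | exists k (x : E k),
                             s = dinj x - dinj (f k x)]%classic).

End DirectSum.

Section LocalCohomology.
Variables (R : comNzRingType) (a : submodClosed R^o).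
Implicit Types M X : lmodType R.

Definition gen_local_cohomology (i : nat) M X : lmodType R :=
  dirlim (E := fun k => Ext i (quotm (powmod a M k)) X)
    (fun k => @Ext_map R _ _ X (quotm_projL (@powmodS_sub R a M k)) i).

Definition local_cohomology (i : nat) X : lmodType R :=
  gen_local_cohomology i R^o X.

End LocalCohomology.

(* Main.v *)
From HB Require Import structures.
From mathcomp Require Import all_boot all_algebra all_classical.
From mathcomp Require Import freeg.
Require Import Defs.

(** Write T^n(M, X) for generalized local cohomology and H^i(X) for T^i(R, X).
    The statement is what the spectral sequence
    Ext^p(M, H^q(X)) => T^{p+q}(M, X) gives; the proof replaces that spectral
    sequence by an induction on n that shifts the dimension in X, and uses no
    injective modules.

    Let E be the product of the localizations X_x, for x running over finitely
    many generators of the ideal a, and e : X -> E the canonical map. Its kernel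
    G is the a-torsion of X. On each factor X_x a power of x acts bijectively on
    X_x but kills M/a^k M, so Ext^j(M/a^k M, E) = 0 for all j and k
    ([exists_effacement]). With Z = E/e(X), chasing cocycles through
    X -> E -> Z gives an exact sequence
      T^{n+1}(M, G) -> T^{n+1}(M, X) -> T^n(M, Z)
    ([from_torsion], [connecting], [connecting_exact]).

    The term in G is controlled by Ext: since G is a-torsion, T^n(M, G) embeds
    in Ext^n(M, G) ([length_torsion]). This is the main use of the Noetherian
    hypothesis. The point is that Tor_i(M, R/a^t) -> Tor_i(M, R/a^s) vanishes for t
    large and i > 0 ([res_approx_exact]), by the Artin-Rees lemma; hence the
    resolution of M/a^l M compares with that of M up to an error in a^s, and
    this error is invisible to a cocycle whose values are killed by a^s
    ([approx_comparison], [torsion_Ext_injective]). Every class is represented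
    by such a cocycle, because a syzygy of a finitely generated module is
    finitely generated up to maps that factor through free modules
    ([cocycle_killed]).

    For M = R, Ext^{i+1}(R, G) = 0, so H^{i+1}(G) = 0 and the exact sequence
    turns into isomorphisms H^{i+1}(X) = H^i(Z)
    ([local_cohomology_shift]); also H^0(X) = G ([local_cohomology0_iso]).
    Therefore
      l(T^{n+1}(M, X)) <= l(Ext^{n+1}(M, H^0(X))) + l(T^n(M, Z)),
    and the induction hypothesis for Z bounds the last term by the sum of the
    l(Ext^{n-i}(M, H^{i+1}(X))). *)

Set Implicit Arguments.
Unset Strict Implicit.
Unset Printing Implicit Defensive.

Import GRing.Theory.
Local Open Scope ring_scope.

(** * Submodules *)

Section PropSubmodule.
Variables (R : comNzRingType) (V : lmodType R) (P : V -> Prop).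

Definition prop_closed :=
  (forall (r : R) u v, P u -> P v -> P (r *: u + v)) /\ P 0.

Definition prop_pred of prop_closed : V -> bool := fun v => `[< P v >].
Fact prop_pred_closed H : GRing.subsemimod_closed (@prop_pred H).
Proof.
case: (H) => PZD P0.
apply: subsemimodP => [|r u v /asboolP Pu /asboolP Pv]; apply/asboolP => //.
exact: PZD.
Qed.
HB.instance Definition _ H :=
  GRing.isSubmodClosed.Build R V (@prop_pred H) (@prop_pred_closed H).

Definition prop_sub H : submodClosed V := (@prop_pred H : {pred V}).

Hypothesis PZD : forall (r : R) u v, P u -> P v -> P (r *: u + v).
Hypothesis P0 : P 0.

Lemma prop_submod : exists S : submodClosed V, forall v, v \in S <-> P v.
Proof.
by exists (prop_sub (conj PZD P0)) => v; split=> /asboolP.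
Qed.

Lemma span_ind (A : set V) : (forall v, A v -> P v) ->
  forall v, v \in span A -> P v.
Proof.
move=> AP v /asboolP /(_ (prop_sub (conj PZD P0))) Av.
by apply/asboolP/Av => x /AP Px; apply/asboolP.
Qed.

End PropSubmodule.

Section SubmoduleLemmas.
Variable R : comNzRingType.
Implicit Types V W : lmodType R.

Lemma submodB V (S : submodClosed V) u v : u \in S -> v \in S -> u - v \in S.
Proof. by move=> uS vS; rewrite -scaleN1r rpredD// rpredZ. Qed.

Lemma span_mem V (A : set V) v : A v -> v \in span A.
Proof. by move=> Av; apply/asboolP => S; apply. Qed.

Lemma span_sub V (A : set V) (S : submodClosed V) :
  (forall v, A v -> v \in S) -> {subset span A <= S}.
Proof. by move=> AS v /asboolP; apply. Qed.

Lemma span_cons V x (s : seq V) v : v \in span [set` x :: s]%classic <->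
  exists (r : R) w, w \in span [set` s]%classic /\ v = r *: x + w.
Proof.
split; last first.
  case=> r [w [ws ->]]; rewrite rpredD ?rpredZ//.
    by apply: span_mem; rewrite /= inE eqxx.
  by apply: span_sub ws => y /= ys; apply: span_mem; rewrite /= inE ys orbT.
move: v; apply: span_ind => [r _ _ [p [w [ws ->]]] [q [z [zs ->]]]||y /=].
- exists (r * p + q), (r *: w + z); rewrite rpredD ?rpredZ//; split=> //.
  by rewrite scalerDr scalerDl scalerA addrACA.
- by exists 0, 0; rewrite rpred0 scale0r addr0.
- rewrite inE => /orP[/eqP->|ys].
    by exists 1, 0; rewrite rpred0 scale1r addr0.
  by exists 0, y; rewrite scale0r add0r; split=> //; apply: span_mem.
Qed.

Lemma span_nil V (v : V) : v \in span [set` [::] : seq V]%classic -> v = 0.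
Proof.
by apply: (@span_ind _ _ (fun v => v = 0)) => // r u w -> ->; rewrite scaler0 addr0.
Qed.

Lemma span_img V W (f : {linear V -> W}) (s : seq V) v :
  v \in span [set` s]%classic -> f v \in span [set` map f s]%classic.
Proof.
apply: (@span_ind _ _ (fun v => f v \in _)) => [r x y fx fy||x xs].
- by rewrite linearP rpredD ?rpredZ.
- by rewrite linear0 rpred0.
- by apply: span_mem; apply: map_f.
Qed.

Lemma ideal_mulP V (a : submodClosed R^o) (S : submodClosed V) (r : R) v :
  r \in a -> v \in S -> r *: v \in ideal_mul a S.
Proof. by move=> ra vS; apply: span_mem; exists r, v. Qed.

Lemma ideal_mul_ind V (a : submodClosed R^o) (S : submodClosed V)
    (P : V -> Prop) :
    (forall r u v, P u -> P v -> P (r *: u + v)) -> P 0 ->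
    (forall (r : R) v, r \in a -> v \in S -> P (r *: v)) ->
  forall v, v \in ideal_mul a S -> P v.
Proof.
by move=> PD P0 Ps; apply: span_ind => // _ [r [m [ra mS ->]]]; apply: Ps.
Qed.

Lemma ideal_mul_sub V (a b : submodClosed R^o) (S T : submodClosed V) :
  {subset a <= b} -> {subset S <= T} ->
  {subset ideal_mul a S <= ideal_mul b T}.
Proof.
move=> ab ST; apply: ideal_mul_ind => [r u v||r v ra vS].
- by move=> *; rewrite rpredD ?rpredZ.
- exact: rpred0.
- by apply: ideal_mulP; [apply: ab|apply: ST].
Qed.

Lemma ideal_mul_subr V (a : submodClosed R^o) (S : submodClosed V) :
  {subset ideal_mul a S <= S}.
Proof.
apply: ideal_mul_ind => [r u v||r v ra vS]; [|exact: rpred0|exact: rpredZ].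
by move=> *; rewrite rpredD ?rpredZ.
Qed.

Lemma ideal_mul_img V W (a : submodClosed R^o) (S : submodClosed V)
    (T : submodClosed W) (f : {linear V -> W}) :
    (forall v, v \in S -> f v \in T) ->
  forall v, v \in ideal_mul a S -> f v \in ideal_mul a T.
Proof.
move=> fST; apply: (@ideal_mul_ind _ _ _ (fun v => f v \in _)).
- by move=> r u v fu fv; rewrite linearP rpredD ?rpredZ.
- by rewrite linear0 rpred0.
- by move=> r v ra vS; rewrite linearZ/= ideal_mulP// fST.
Qed.

Lemma ideal_exp_sub (a : submodClosed R^o) k l :
  (k <= l)%N -> {subset ideal_exp a l <= ideal_exp a k}.
Proof.
move=> /subnK <-; elim: (l - k)%N => [//|j IH] x /ideal_expS_sub; exact: IH.
Qed.

Lemma powmod_sub (a : submodClosed R^o) V k l :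
  (k <= l)%N -> {subset powmod a V l <= powmod a V k}.
Proof. by move=> kl; apply: ideal_mul_sub => //; apply: ideal_exp_sub. Qed.

Lemma powmod_img (a : submodClosed R^o) V W k (f : {linear V -> W}) v :
  v \in powmod a V k -> f v \in powmod a W k.
Proof. exact: ideal_mul_img. Qed.

Lemma powmodP (a : submodClosed R^o) V k (r : R) (v : V) :
  r \in ideal_exp a k -> r *: v \in powmod a V k.
Proof. by move=> ra; apply: ideal_mulP. Qed.

Lemma ideal_expX (a : submodClosed R^o) (r : R) k :
  r \in a -> r ^+ k \in ideal_exp a k.
Proof.
move=> ra; elim: k => [//|k IH]; rewrite exprS.
exact: (@ideal_mulP R^o).
Qed.

End SubmoduleLemmas.

(** * Noetherian modules and powers of ideals *)

Section Noetherian.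
Variable R : comNzRingType.
Implicit Types V W : lmodType R.

Lemma seq_uniform_bound V (s : seq V) (Q : nat -> V -> Prop) :
    (forall m m' v, (m <= m')%N -> Q m v -> Q m' v) ->
    (forall v, v \in s -> exists m, Q m v) ->
  exists m, forall v, v \in s -> Q m v.
Proof.
move=> Qm; elim: s => [|x s IH] Qs; first by exists 0.
case: IH => [v vs|m mP]; first by apply: Qs; rewrite inE vs orbT.
case: (Qs x) => [|l lP]; first by rewrite inE eqxx.
exists (maxn l m) => v; rewrite inE => /orP[/eqP->|vs].
  exact: Qm (leq_maxl _ _) lP.
exact: Qm (leq_maxr _ _) (mP _ vs).
Qed.

(** Induction on the generators: for v = r x + w with w in the span of the
    others, the coefficients r form a finitely generated ideal; lifting its
    generators into S leaves a part of S inside the smaller span. *)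
Lemma noetherian_submod (hR : noetherian R) V (s : seq V) (S : submodClosed V) :
    {subset S <= span [set` s]%classic} ->
  exists s' : seq V, span [set` s']%classic =i S.
Proof.
elim: s S => [|x s IH] S Ss.
  exists [::] => v; apply/idP/idP => [/span_nil ->|/Ss/span_nil ->];
    exact: rpred0.
pose P (r : R^o) := exists w, w \in span [set` s]%classic /\ r *: x + w \in S.
have [I IP] : exists I : submodClosed R^o, forall r, r \in I <-> P r.
  apply: prop_submod => [r p q [w [ws wS]] [z [zs zS]]|].
    exists (r *: w + z); rewrite rpredD ?rpredZ//; split=> //.
    by rewrite [r *: p + q]/(r * p + q) scalerDl -scalerA addrACA -scalerDr
      rpredD ?rpredZ.
  by exists 0; rewrite rpred0 scale0r addr0 rpred0.
have [rs rsI] := hR I.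
have /choice[w wP] : forall r, exists w, r \in rs ->
    w \in span [set` s]%classic /\ r *: x + w \in S.
  move=> r; case: (boolP (r \in rs)) => [rrs|_]; last by exists 0.
  have /IP[w [ws wS]] : r \in I by rewrite -rsI; apply: span_mem.
  by exists w.
have [T TP] : exists T : submodClosed V,
    forall v, v \in T <-> v \in S /\ v \in span [set` s]%classic.
  apply: prop_submod => [r u v [uS us] [vS vs]|]; last by rewrite !rpred0.
  by split; rewrite rpredD ?rpredZ.
have [t tT] : exists t : seq V, span [set` t]%classic =i T.
  by apply: IH => v /TP[].
pose ys := [seq (r : R) *: x + w r | r <- rs].
have yS : {subset ys <= S} by move=> _ /mapP[r /wP[_ ?] ->].
exists (ys ++ t) => v; apply/idP/idP => [|vS].
  apply: span_sub => z /=; rewrite mem_cat => /orP[/yS//|zt].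
  by have /TP[] : z \in T by rewrite -tT; apply: span_mem.
have sub1 : {subset span [set` ys]%classic <= span [set` ys ++ t]%classic}.
  by apply: span_sub => z /= zy; apply: span_mem; rewrite /= mem_cat zy.
have sub2 : {subset span [set` t]%classic <= span [set` ys ++ t]%classic}.
  by apply: span_sub => z /= zy; apply: span_mem; rewrite /= mem_cat zy orbT.
have lift (r : R^o) : r \in span [set` rs]%classic -> exists u,
    u \in span [set` s]%classic /\
    (r : R) *: x + u \in span [set` ys]%classic.
  move: r; apply: span_ind => [r p q [u [us uy]] [z [zs zy]]||r rrs].
  - exists (r *: u + z); rewrite rpredD ?rpredZ//; split=> //.
    by rewrite [r *: p + q]/(r * p + q) scalerDl -scalerA addrACA -scalerDr
      rpredD ?rpredZ.
  - by exists 0; rewrite rpred0 scale0r addr0 rpred0.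
  - exists (w r); split; first by case: (wP r rrs).
    by apply: span_mem; apply: map_f.
have /span_cons[r [z [zs vE]]] := Ss _ vS.
have rI : r \in I by apply/IP; exists z; rewrite -vE.
have [|u [us uy]] := lift r; first by rewrite rsI.
rewrite -(subrK (r *: x + u) v) rpredD//; last exact: sub1.
apply: sub2; rewrite tT; apply/TP; split.
  apply: submodB => //; move: uy; apply: span_sub; exact: yS.
by rewrite vE opprD addrACA subrr add0r submodB.
Qed.

(** If a is contained in (x) + b, then a^(i+j) is contained in (x^i) + b^j:
    one more factor from a either raises the exponent of x or lies in b. *)
Lemma ideal_exp_split (a b : submodClosed R^o) (x : R) i j (r : R) :
    (forall y : R, y \in a -> exists p c : R, c \in b /\ y = p * x + c) ->
    r \in ideal_exp a (i + j) ->
  exists p c : R, c \in ideal_exp b j /\ r = p * x ^+ i + c.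
Proof.
move=> ab; move Ek: (i + j)%N => k; elim: k i j Ek r => [|k IH] i j Ek r.
  move/eqP: Ek; rewrite addn_eq0 => /andP[/eqP-> /eqP->] _.
  by exists 0, r; rewrite mul0r add0r.
case: i Ek => [|i] Ek.
  by exists r, 0; split; [exact: rpred0|rewrite addr0 mulr1].
case: j Ek => [|j] Ek.
  by exists 0, r; rewrite mul0r add0r.
have H : forall r : R^o, r \in ideal_exp a k.+1 ->
  exists p c : R, c \in ideal_exp b j.+1 /\ r = p * x ^+ i.+1 + c.
  apply: ideal_mul_ind => [q u v [p [c [cb ->]]] [p' [c' [cb' ->]]]||q v qa va].
  - exists (q * p + p'), (q *: (c : R^o) + c').
    split; first by apply: rpredD => //; apply: rpredZ.
    by rewrite -[LHS]/(q * _ + _) mulrDr mulrDl mulrA addrACA.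
  - by exists 0, 0; split; [exact: rpred0|rewrite mul0r addr0].
  - have [p [c [cb qE]]] := ab q qa.
    have [|p1 [c1 [cb1 vE]]] := IH i j.+1 _ v va.
      by move: Ek; rewrite addSn => -[].
    have [|p2 [c2 [cb2 vE2]]] := IH i.+1 j _ v va.
      by move: Ek; rewrite addnS => -[].
    exists (p * p1 + c * p2), ((p * x) *: (c1 : R^o) + c * c2); split.
      by apply: rpredD; [apply: rpredZ|apply: (@ideal_mulP _ R^o)].
    transitivity (p * x * (p1 * x ^+ i + c1) + c * (p2 * x ^+ i.+1 + c2)).
      by rewrite -vE -vE2 -mulrDl -qE.
    rewrite [_ *: _]/(p * x * c1) !mulrDr mulrDl addrACA !mulrA.
    by congr (_ + _ + _); rewrite exprS !mulrA; congr (_ * _); rewrite mulrAC.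
exact: H.
Qed.

(** Applied to annihilators, this shows that an element killed by a power of
    each generator is killed by a power of the ideal. *)
Lemma ideal_exp_subset_gen (xs : seq R^o) (J : submodClosed R^o) :
    (forall x : R, x \in xs -> exists m, (x ^+ m : R) \in J) ->
  exists t, {subset ideal_exp (span [set` xs]%classic) t <= J}.
Proof.
elim: xs => [|x xs IH] xJ.
  exists 1%N => r; move: r.
  apply: ideal_mul_ind => [r u v uJ vJ||r v /span_nil -> _].
  - by rewrite rpredD ?rpredZ.
  - exact: rpred0.
  - by rewrite scale0r rpred0.
case: IH => [y yxs|t tJ]; first by apply: xJ; rewrite inE yxs orbT.
have [|m mJ] := xJ x; first by rewrite inE eqxx.
exists (m + t)%N => r.
move=> /(ideal_exp_split (b := span [set` xs]%classic) (x := x))[].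
  by move=> y /span_cons[p [c [cb ->]]]; exists p, c.
move=> p [c [/tJ cJ ->]]; rewrite rpredD//.
exact: (@rpredZ _ R^o J p _ mJ).
Qed.

End Noetherian.

(** * A weak form of the Artin-Rees lemma *)

Section ArtinRees.
Variable R : comNzRingType.
Implicit Types V W : lmodType R.

(** Zorn's lemma. The family consists of the sets that become such an L after
    adjoining Q, so that the empty chain is bounded by the empty set. *)
Lemma maximal_submod_meet V (K Q : submodClosed V) :
    {subset Q <= K} ->
  exists L : submodClosed V,
    [/\ {subset Q <= L}, forall v, v \in L -> v \in K -> v \in Q &
     forall L' : submodClosed V, {subset L <= L'} ->
       (forall v, v \in L' -> v \in K -> v \in Q) -> {subset L' <= L}].
Proof.
move=> QK.
pose P (A : set V) := exists L : submodClosed V,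
  (forall v, v \in L <-> A v \/ v \in Q) /\
  forall v, v \in L -> v \in K -> v \in Q.
have [F FP Ftot|A [[L [LA LK]] Amax]] := @Zorn_bigcup V P.
  have [L LE] : exists L : submodClosed V,
      forall v, v \in L <-> (\bigcup_(X in F) X)%classic v \/ v \in Q.
    apply: prop_submod => [r u v|]; last by right; exact: rpred0.
    move=> [[A FA Au]|uQ] [[B FB Bv]|vQ].
    - have [C [FC Cu Cv]] : exists C, [/\ F C, C u & C v].
        by case: (Ftot _ _ FA FB) => AB; [exists B|exists A]; split=> //;
          apply: AB.
      have [L [LE _]] := FP _ FC.
      have /LE[Cuv|] : r *: u + v \in L.
        by rewrite rpredD ?rpredZ//; apply/LE; left.
      + by left; exists C.
      + by right.
    - have [L [LE _]] := FP _ FA.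
      have /LE[Cuv|] : r *: u + v \in L.
        by rewrite rpredD ?rpredZ//; apply/LE; [left|right].
      + by left; exists A.
      + by right.
    - have [L [LE _]] := FP _ FB.
      have /LE[Cuv|] : r *: u + v \in L.
        by rewrite rpredD ?rpredZ//; apply/LE; [right|left].
      + by left; exists B.
      + by right.
    - by right; rewrite rpredD ?rpredZ.
  exists L; split=> // v /LE[[A FA Av] vK|//].
  by have [L' [L'E L'K]] := FP _ FA; apply: L'K => //; apply/L'E; left.
exists L; split=> // [v vQ|L' LL' L'K v vL']; first by apply/LA; right.
apply: contrapT => vL; apply: (Amax [set` L']%classic).
  split=> [u Au|sub]; first by apply/LL'/LA; left.
  by apply: vL; apply/LA; left; apply: sub.
exists L'; split=> // u; split=> [|[]//]; first by left.
by move=> uQ; apply/LL'/LA; right.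
Qed.

Lemma ideal_exp_eq (a b : submodClosed R^o) k :
  b =i a -> ideal_exp b k =i ideal_exp a k.
Proof.
move=> ba; elim: k => [//|k IH] x.
by apply/idP/idP; apply: ideal_mul_sub => y; rewrite ?ba// IH.
Qed.

(** This qualitative version avoids the Rees algebra. Let Q = a^k K and take L
    maximal with L /\ K = Q. For x in a the submodules of N consisting of the y
    with x^m y in L stabilize at some m, and then (L + x^m N) /\ K = Q, so that
    x^m N is contained in L by maximality. Hence a power of a maps N into L, and
    meets K inside Q. *)
Lemma artin_rees (hR : noetherian R) (a : submodClosed R^o) V (s : seq V)
    (K : submodClosed V) k :
    {subset K <= span [set` s]%classic} ->
  exists t, forall v, v \in ideal_mul (ideal_exp a t) (span [set` s]%classic) ->
    v \in K -> v \in ideal_mul (ideal_exp a k) K.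
Proof.
move=> Ks; set N := span _; set Q := ideal_mul _ _.
have QK : {subset Q <= K} by apply: ideal_mul_subr.
have [L [QL LK Lmax]] := maximal_submod_meet QK.
have pow (x : R) : x \in a -> exists m, forall y, y \in N -> x ^+ m *: y \in L.
  move=> xa.
  have [U UE] : exists U : submodClosed V,
      forall y, y \in U <-> y \in N /\ exists m, x ^+ m *: y \in L.
    apply: prop_submod => [r u v [uN [m mL]] [vN [l lL]]|].
      split; first by rewrite rpredD ?rpredZ.
      exists (m + l)%N; rewrite scalerDr scalerA mulrC -scalerA rpredD//.
        by rewrite rpredZ// addnC exprD -scalerA rpredZ.
      by rewrite exprD -scalerA rpredZ.
    by rewrite rpred0; split=> //; exists 0%N; rewrite scaler0 rpred0.
  have [u uU] : exists u : seq V, span [set` u]%classic =i U.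
    by apply: (noetherian_submod hR (s := s)) => v /UE[].
  have [m mP] : exists m, forall y, y \in u -> x ^+ m *: y \in L.
    apply: (seq_uniform_bound (Q := fun m y => x ^+ m *: y \in L)).
      by move=> l l' v /subnK <- vL; rewrite exprD -scalerA rpredZ.
    by move=> v vu; have /UE[] : v \in U by rewrite -uU span_mem.
  have mU y : y \in U -> x ^+ m *: y \in L.
    rewrite -uU; move: y; apply: span_ind => //.
      by move=> r p q pL qL; rewrite scalerDr scalerA mulrC -scalerA
        rpredD// rpredZ.
    by rewrite scaler0 rpred0.
  exists m.
  have [L' L'E] : exists L' : submodClosed V, forall v, v \in L' <->
      exists l y, [/\ l \in L, y \in N & v = l + x ^+ m *: y].
    apply: prop_submod => [r _ _ [l [y [lL yN ->]]] [p [z [pL zN ->]]]|].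
      exists (r *: l + p), (r *: y + z); split; rewrite ?rpredD ?rpredZ//.
      by rewrite !scalerDr !scalerA mulrC addrACA.
    by exists 0, 0; rewrite !rpred0 scaler0 addr0.
  move=> y yN; apply: (Lmax L').
  - by move=> l lL; apply/L'E; exists l, 0; rewrite rpred0 scaler0 addr0.
  - move=> _ /L'E[l [z [lL zN ->]]] lzK; apply: LK => //.
    rewrite rpredD// mU//; apply/UE; split=> //; exists (k + m)%N.
    (* x^k maps l + x^m z, an element of K, into a^k K, hence into L. *)
    rewrite exprD -scalerA -[_ *: z](addKr l) scalerDr rpredD//.
      by rewrite scalerN -scaleNr rpredZ.
    by apply/QL/ideal_mulP => //; apply: ideal_expX.
  - by apply/L'E; exists 0, y; rewrite rpred0 add0r.
have [J JE] : exists J : submodClosed R^o,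
    forall r : R, r \in J <-> forall y, y \in N -> r *: y \in L.
  apply: (@prop_submod _ R^o (fun r : R => forall y, y \in N -> r *: y \in L)).
    move=> r p q pL qL y yN.
    by rewrite scalerDl rpredD ?qL// -scalerA rpredZ ?pL.
  by move=> y yN; rewrite scale0r rpred0.
have [xs xsa] := hR a.
have [x xxs|t tJ] := @ideal_exp_subset_gen R xs J.
  have [|m mP] := pow x; first by rewrite -xsa span_mem.
  by exists m; apply/JE.
exists t => v va vK; apply: LK => //; move: v va {vK}.
apply: ideal_mul_ind => [r u v uL vL||r v ra vN].
- by rewrite rpredD ?rpredZ.
- exact: rpred0.
- have /JE : r \in J; last exact.
  by apply: tJ; rewrite (ideal_exp_eq t xsa).
Qed.

End ArtinRees.

(** * Lifting along free modules, and multiplication by a scalar on syzygies *)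

Section LinearMaps.
Variable R : comNzRingType.
Implicit Types U V W A B X : lmodType R.

Section MkLinear.
Variables (V W : lmodType R) (f : V -> W).
(** The proof of linearity is an argument so that the linear structure of
    [lin_fun] can be inferred. *)
Definition lin_fun of linear f : V -> W := f.
HB.instance Definition _ (H : linear f) :=
  GRing.isLinear.Build R V W _ (lin_fun H) H.
Definition mk_linear (H : linear f) : {linear V -> W} := lin_fun H.
End MkLinear.

Lemma corestrict V W (f : {linear V -> W}) (S : submodClosed W) :
    (forall v, f v \in S) ->
  exists g : {linear V -> subm S}, forall v, subm_val (g v) = f v.
Proof.
move=> fS; suff H : linear (fun v => Subm (fS v)) by exists (mk_linear H).
by move=> r u v; apply: val_inj; rewrite /= linearP.
Qed.

Lemma factor_surj V W X (p : {linear V -> W}) (c : {linear V -> X}) :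
    (forall w, exists v, p v = w) -> (forall v, p v = 0 -> c v = 0) ->
  exists f : {linear W -> X}, forall v, c v = f (p v).
Proof.
move=> /choice[q pq] c0.
have cq v : c v = c (q (p v)).
  by apply/eqP; rewrite -subr_eq0 -linearB c0// linearB pq subrr.
suff H : linear (c \o q) by exists (mk_linear H).
by move=> r u v /=; rewrite -linearP [RHS]cq linearP !pq.
Qed.

Lemma linear_inverse V W (f : {linear V -> W}) :
    (forall v, f v = 0 -> v = 0) -> (forall w, exists v, f v = w) ->
  exists g : {linear W -> V}, cancel f g /\ cancel g f.
Proof.
move=> f0 fs; have [|g gP] := @factor_surj V W V f idfun fs; first exact: f0.
by exists g; split=> [v|w]; [rewrite -gP | have [v <-] := fs w; rewrite -gP].
Qed.

Lemma span_preimg V W (f : {linear V -> W}) (s : seq V) w :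
  w \in span [set` map f s]%classic ->
  exists2 v, v \in span [set` s]%classic & f v = w.
Proof.
move: w; apply: span_ind => [r _ _ [u us <-] [v vs <-]||_ /mapP[v vs ->]].
- by exists (r *: u + v); rewrite ?linearP// rpredD ?rpredZ.
- by exists 0; rewrite ?linear0// rpred0.
- by exists v => //; apply: span_mem.
Qed.

Lemma ideal_mul_preimg V W (a : submodClosed R^o) (S : submodClosed V)
    (T : submodClosed W) (f : {linear V -> W}) :
    (forall w, w \in T -> exists2 v, v \in S & f v = w) ->
  forall w, w \in ideal_mul a T -> exists2 v, v \in ideal_mul a S & f v = w.
Proof.
move=> fST.
apply: ideal_mul_ind => [r _ _ [u uS <-] [v vS <-]||r _ ra /fST[v vS <-]].
- by exists (r *: u + v); rewrite ?linearP// rpredD ?rpredZ.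
- by exists 0; rewrite ?linear0// rpred0.
- by exists (r *: v); rewrite ?linearZ// ideal_mulP.
Qed.

Lemma augU U (u : U) : aug U << u >> = u.
Proof. exact: free_liftU. Qed.

Lemma aug_surj U (u : U) : exists y, aug U y = u.
Proof. by exists << u >>; apply: augU. Qed.

(** Freeness: a lift modulo J may be chosen independently on the basis. *)
Lemma free_choose U A B (f : {linear freem U -> A}) (g : {linear B -> A})
    (J : submodClosed A) :
    (forall u, exists b, f << u >> - g b \in J) ->
  exists h : {linear freem U -> B}, forall y, f y - g (h y) \in J.
Proof.
move=> /choice[h0 hP]; exists (free_liftL h0) => y.
pose p : {linear A -> quotm J} := quotm_pi J.
rewrite -quotm_eqE.
rewrite -[X in X == _]/((p \o f) y) -[X in _ == X]/((p \o (g \o free_liftL h0)) y).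
apply/eqP/free_ext => u /=; apply/eqP.
by rewrite free_liftU quotm_eqE.
Qed.

Lemma free_lift_exact U A B (f : {linear freem U -> A}) (g : {linear B -> A}) :
    (forall u, exists b, f << u >> = g b) ->
  exists h : {linear freem U -> B}, forall y, f y = g (h y).
Proof.
move=> fg; have [u|h hP] := @free_choose U A B f g (ker (idfun : {linear A -> A})).
  by have [b ->] := fg u; exists b; rewrite subrr rpred0.
by exists h => y; apply/eqP; rewrite -subr_eq0; apply: hP.
Qed.

Lemma free_lift_in U A (h : U -> A) (S : submodClosed A) :
  (forall u, h u \in S) -> forall y, free_liftL h y \in S.
Proof.
move=> hS y; pose p : {linear A -> quotm S} := quotm_pi S.
rewrite -[free_liftL h y]subr0 -quotm_eqE.
rewrite -[X in X == _]/((p \o free_liftL h) y) -[X in _ == X]/(p 0) linear0.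
rewrite -[X in _ == X]/((\0 : {linear freem U -> _}) y).
apply/eqP/free_ext => u /=.
by apply/eqP; rewrite free_liftU -[X in _ == X](linear0 p) quotm_eqE subr0.
Qed.

End LinearMaps.

Section Syzygies.
Variable R : comNzRingType.
Implicit Types N U V W X : lmodType R.

Local Notation syz1 U := (subm (ker (aug U))).

Lemma syz1_aug U (z : syz1 U) : aug U (subm_val z) = 0.
Proof. by case: z => z /=; rewrite unfold_in => /eqP. Qed.

Lemma aug_syz1 U (y : freem U) : aug U y = 0 -> exists z : syz1 U, subm_val z = y.
Proof.
move=> y0; have yK : y \in ker (aug U) by rewrite unfold_in /ker_pred y0.
by exists (Subm yK).
Qed.

(** Dimension shift for maps that factor through a free module. If an endomorphism
    of U equals aug \o al and th lifts it to freem U, then th - al \o aug takes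
    values in the first syzygy K and agrees with th on K. So the endomorphism
    that th induces on K again factors through a free module, and moreover
    extends from K to freem U. *)
Lemma factor_syz U (th : {linear freem U -> freem U})
    (al : {linear U -> freem U}) :
    (forall y, aug U (th y) = aug U (al (aug U y))) ->
  exists (ta : {linear freem U -> syz1 U})
         (al' : {linear syz1 U -> freem (syz1 U)}),
    (forall z : syz1 U, th (subm_val z) = subm_val (ta (subm_val z))) /\
    forall z : syz1 U, aug _ (al' z) = ta (subm_val z).
Proof.
move=> thE; pose f : {linear freem U -> freem U} := th \- (al \o aug U).
have [|ta taE] := @corestrict _ _ _ f (ker (aug U)).
  by move=> y; rewrite unfold_in /ker_pred /= linearB thE subrr.
have [u|be beE] := @free_lift_exact _ _ _ _ ta (aug (syz1 U)).
  by have [y <-] := aug_surj (ta << u >>); exists y.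
exists ta, (be \o @subm_val _ _ _); split=> z /=; last by rewrite -beE.
by rewrite taE /= syz1_aug linear0 subr0.
Qed.

Lemma res_exact N i (y : res N i) :
  aug (syz N i) y = 0 -> exists z, y = res_diff N i z.
Proof.
by move=> /aug_syz1[z <-]; exists << z >>; rewrite /res_diff /= augU.
Qed.

Lemma aug_res_diff N i y : aug (syz N i) (res_diff N i y) = 0.
Proof. exact: (@syz1_aug (syz N i)). Qed.

Lemma cocycle_factor N X i (c : {linear res N i -> X}) :
    (forall y, c (res_diff N i y) = 0) ->
  exists f : {linear syz N i -> X}, forall y, c y = f (aug _ y).
Proof.
move=> c0; apply: factor_surj; first exact: aug_surj.
by move=> y /res_exact[z ->].
Qed.

Lemma syz_scale_factor N (r : R) (al : {linear N -> freem N}) i :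
    (forall v, aug N (al v) = r *: v) ->
  exists al' : {linear syz N i -> freem (syz N i)},
    forall v, aug _ (al' v) = r *: v.
Proof.
move=> alr; elim: i => [|i [be beE]]; first by exists al.
have [|ta [al' [taE al'E]]] :=
    @factor_syz (syz N i) (r \*: (idfun : {linear res N i -> res N i})) be.
  by move=> y /=; rewrite linearZ beE.
by exists al' => z; rewrite al'E; apply: val_inj; rewrite /= -taE.
Qed.

(** By [factor_syz], multiplication by r on the syzygy extends to the previous
    free module, so that r times a cocycle is a coboundary. This is used for r
    annihilating N and for r = 1 on N = R. *)
Lemma scale_cobound N X (r : R) (al : {linear N -> freem N}) i
    (c : {linear res N i.+1 -> X}) :
    (forall v, aug N (al v) = r *: v) ->
    (forall y, c (res_diff N i.+1 y) = 0) ->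
  exists u : {linear res N i -> X}, forall y, r *: c y = u (res_diff N i y).
Proof.
move=> /(@syz_scale_factor _ _ _ i)[be beE] /cocycle_factor[f fE].
have [|ta [_ [taE _]]] :=
    @factor_syz (syz N i) (r \*: (idfun : {linear res N i -> res N i})) be.
  by move=> y /=; rewrite linearZ beE.
exists (f \o ta) => y /=; rewrite fE -linearZ; congr (f _).
by apply: val_inj; apply: (taE (aug _ y)).
Qed.

End Syzygies.

(** * Syzygies of finitely generated modules and torsion cochains *)

Section FgUpToFree.
Variables (R : comNzRingType) (hR : noetherian R).
Implicit Types N U V W X G : lmodType R.

Local Notation syz1 U := (subm (ker (aug U))).

(** The canonical resolution consists of enormous free modules, so its syzygies
    are finitely generated only up to a map factoring through a free module:
    rho has finitely generated image and the identity minus rho factors through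
    aug. *)
Definition fg_mod_free U := exists (s : seq U) (rho : {linear U -> U})
    (al : {linear U -> freem U}),
  (forall u, rho u \in span [set` s]%classic) /\
  forall u, u = rho u + aug U (al u).

Lemma fg_mod_free_fg U : finitely_generated U -> fg_mod_free U.
Proof.
move=> [s sE]; exists s, idfun, \0; split=> u /=; first by rewrite sE.
by rewrite linear0 addr0.
Qed.

(** The induction step along the canonical resolution, with all the data on
    K = syz1 U that is needed below: rho' = rho0 restricted to K has finitely
    generated image, and the difference from the identity extends to freem U
    as ta. *)
Lemma fg_mod_free_step U : fg_mod_free U ->
  exists (S : seq (freem U)) (rho0 : {linear freem U -> freem U})
         (ta : {linear freem U -> syz1 U})
         (s' : seq (syz1 U)) (rho' : {linear syz1 U -> syz1 U}),
  [/\ forall y, rho0 y \in span [set` S]%classic,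
      forall z, rho' z \in span [set` s']%classic,
      forall z : syz1 U, subm_val (rho' z) = rho0 (subm_val z),
      forall z : syz1 U, z = rho' z + ta (subm_val z) &
      fg_mod_free (syz1 U)].
Proof.
move=> [s [rho [al [rhos alE]]]].
pose S := [seq (<< u >> : freem U) | u <- s].
have Ss : map (aug U) S = s.
  by rewrite -map_comp map_id_in// => u _ /=; rewrite augU.
have /choice[h hP] u :
    exists e, e \in span [set` S]%classic /\ aug U e = rho u.
  have [|e eS <-] := @span_preimg _ _ _ (aug U) S (rho u); first by rewrite Ss.
  by exists e.
pose rho0 := free_liftL h.
have rho0S y : rho0 y \in span [set` S]%classic.
  by apply: free_lift_in => u; case: (hP u).
have rho0E y : aug U (rho0 y) = rho (aug U y).
  apply: (@free_ext _ _ _ (aug U \o rho0) (rho \o aug U)) => u /=.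
  by rewrite free_liftU augU; case: (hP u).
have [|ta [al' [taE al'E]]] :=
    @factor_syz _ U ((idfun : {linear _ -> _}) \- rho0) al.
  move=> y /=; rewrite linearB rho0E {1}[aug U y]alE.
  by rewrite addrC addKr.
have [rho' rho'E] : exists rho' : {linear syz1 U -> syz1 U},
    forall z, subm_val (rho' z) = rho0 (subm_val z).
  apply: (@corestrict _ _ _ (rho0 \o @subm_val _ _ _)) => z.
  by rewrite unfold_in /ker_pred /= rho0E syz1_aug linear0.
have rta (z : syz1 U) : z = rho' z + ta (subm_val z).
  by apply: val_inj => /=; rewrite -taE /= rho'E addrC subrK.
have [T TE] : exists T : submodClosed (syz1 U), forall z, z \in T <->
    subm_val z \in span [set` S]%classic.
  apply: prop_submod => [r u v uS vS|]; last by rewrite rpred0.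
  by rewrite linearP rpredD// rpredZ.
have [T1 T1E] : exists T1 : submodClosed (freem U), forall y, y \in T1 <->
    y \in span [set` S]%classic /\ y \in ker (aug U).
  apply: prop_submod => [r u v [uS uK] [vS vK]|]; last by rewrite !rpred0.
  by split; apply: rpredD => //; apply: rpredZ.
have [|t tE] := @noetherian_submod _ hR _ S T1; first by move=> y /T1E[].
have [s' s'E] : exists s' : seq (syz1 U), map (@subm_val _ _ _) s' = t.
  have : forall y, y \in t -> y \in ker (aug U).
    by move=> y yt; have /T1E[] : y \in T1 by rewrite -tE span_mem.
  elim: (t) => [|y t' IH] tK; first by exists [::].
  have [|s' <-] := IH; first by move=> z zt; apply: tK; rewrite inE zt orbT.
  have yK : y \in ker (aug U) by apply: tK; rewrite inE eqxx.
  by exists (Subm yK :: s').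
have rho's z : rho' z \in span [set` s']%classic.
  have : subm_val (rho' z) \in T1.
    apply/T1E; split; first by rewrite rho'E.
    by rewrite unfold_in /ker_pred syz1_aug.
  rewrite -tE -s'E => /(@span_preimg _ _ _ (@subm_val _ _ _))[w ws wE].
  by rewrite -(val_inj wE).
exists S, rho0, ta, s', rho'; split=> //.
exists s', rho', al'; split=> // z.
by rewrite al'E -rta.
Qed.

Lemma fg_mod_free_syz N i : finitely_generated N -> fg_mod_free (syz N i).
Proof.
move=> /fg_mod_free_fg; elim: i => [//|i IH] /IH /fg_mod_free_step.
by move=> [? [? [? [? [? []]]]]].
Qed.

Variable a : submodClosed R^o.

(** Artin-Rees for the inclusion of K = syz1 U in freem U. Split z as
    rho0 z + ta z: the first term lies in a finitely generated module, where
    Artin-Rees applies, and ta is linear on freem U with values in K. *)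
Lemma syz_artin_rees U k : fg_mod_free U -> exists t, forall z : syz1 U,
  subm_val z \in powmod a (freem U) t -> z \in powmod a (syz1 U) k.
Proof.
move=> /fg_mod_free_step[S [rho0 [ta [s' [rho' [rho0S _ rho'E rta _]]]]]].
have [T TE] : exists T : submodClosed (freem U), forall y, y \in T <->
    y \in span [set` S]%classic /\ y \in ker (aug U).
  apply: prop_submod => [r u v [uS uK] [vS vK]|]; last by rewrite !rpred0.
  by split; apply: rpredD => //; apply: rpredZ.
have [|t tP] := @artin_rees _ hR a _ S T k; first by move=> y /TE[].
exists (maxn t k) => z za; rewrite (rta z) rpredD//; last first.
  apply: (powmod_sub (leq_maxr t k)); exact: powmod_img.
have : subm_val (rho' z) \in ideal_mul (ideal_exp a k) T.
  apply: tP.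
    rewrite rho'E; apply: ideal_mul_img (powmod_sub (leq_maxl t k) za) => //.
  by apply/TE; split; [rewrite rho'E|rewrite unfold_in /ker_pred syz1_aug].
have lift w : w \in T -> exists2 v : syz1 U, v \in full _ & subm_val v = w.
  by move=> /TE[_]; rewrite unfold_in => /eqP/aug_syz1[v <-]; exists v.
by move=> /(ideal_mul_preimg lift)[v va /val_inj <-].
Qed.

Lemma powmod_surj V W (f : {linear V -> W}) k w :
    (forall w, exists v, f v = w) -> w \in powmod a W k ->
  exists2 v, v \in powmod a V k & f v = w.
Proof.
move=> fs; apply: ideal_mul_preimg => w' _; by have [v <-] := fs w'; exists v.
Qed.

Lemma res_lift_mod N i k (y : res N i) :
  aug _ y \in powmod a (syz N i) k ->
  exists z, y - res_diff N i z \in powmod a (res N i) k.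
Proof.
move=> /(powmod_surj (@aug_surj _ _))[y' y'a y'E].
have [|z zE] := @res_exact _ N i (y - y'); first by rewrite linearB y'E subrr.
by exists z; rewrite -zE opprB addrC subrK.
Qed.

(** Exactness survives reduction modulo powers of a, at the cost of changing the
    power: this expresses that Tor_{i+1}(N, R/a^t) -> Tor_{i+1}(N, R/a^k) is
    zero for t large. *)
Lemma res_approx_exact N i k : finitely_generated N ->
  exists t, forall y, res_diff N i y \in powmod a (res N i) t ->
    exists z, y - res_diff N i.+1 z \in powmod a (res N i.+1) k.
Proof.
move=> /(@fg_mod_free_syz _ i) fgi.
have [t tP] := syz_artin_rees k fgi.
exists t => y dy; apply: res_lift_mod; exact: tP.
Qed.

Definition torsion G := forall v : G, exists k, forall r : R,
  r \in ideal_exp a k -> r *: v = 0.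

Definition kills V W k (f : V -> W) := forall v, v \in powmod a V k -> f v = 0.

Lemma kills_le V W k l (f : V -> W) : (k <= l)%N -> kills k f -> kills l f.
Proof. by move=> kl fk v /(powmod_sub kl)/fk. Qed.

Lemma kills_fg_image V W G (s : seq W) (f : {linear V -> W})
    (g : {linear W -> G}) :
    torsion G -> (forall v, f v \in span [set` s]%classic) ->
  exists k, kills k (g \o f).
Proof.
move=> Gt fs.
have [k kP] : exists k, forall w, w \in s ->
    forall r : R, r \in ideal_exp a k -> r *: g w = 0.
  apply: (seq_uniform_bound
    (Q := fun k w => forall r : R, r \in ideal_exp a k -> r *: g w = 0)) => //.
  by move=> m m' v mm' mP r /(ideal_exp_sub mm')/mP.
have kP' w : w \in span [set` s]%classic ->
    forall r : R, r \in ideal_exp a k -> r *: g w = 0.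
  move: w; apply: span_ind => // [p u v uP vP r ra|r _].
    by rewrite linearP scalerDr scalerA mulrC -scalerA uP// vP// scaler0 addr0.
  by rewrite linear0 scaler0.
exists k; apply: ideal_mul_ind => /= [r u v fu fv||r v ra _].
- by rewrite !linearP fu fv scaler0 addr0.
- by rewrite !linear0.
- by rewrite !linearZ/= kP'.
Qed.

(** Factor the cocycle as f \o aug and replace f by f \o rho': the difference
    extends to the previous free module, hence is a coboundary, while the image
    of f \o rho' is finitely generated in a torsion module. *)
Lemma cocycle_killed N G i (c : {linear res N i.+1 -> G}) :
    finitely_generated N -> torsion G ->
    (forall y, c (res_diff N i.+1 y) = 0) ->
  exists (c' : {linear res N i.+1 -> G}) (u : {linear res N i -> G}) k,
    kills k c' /\ forall y, c y = c' y + u (res_diff N i y).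
Proof.
move=> /(@fg_mod_free_syz _ i)/fg_mod_free_step Nf Gt /cocycle_factor[f fE].
move: Nf => [S [rho0 [ta [s' [rho' [rho0S rho's rho'E rta _]]]]]].
have [k kP] := kills_fg_image f Gt rho's.
exists (f \o (rho' \o aug (syz N i.+1))), (f \o ta), k; split=> [v vk|y] /=.
  by apply: kP; apply: powmod_img.
by rewrite fE {1}[aug _ y]rta linearD.
Qed.

(** Same idea one degree lower: on the syzygy, g is replaced by g \o rho0, which
    has a finitely generated image, and corrected by the extension of f along
    ta. *)
Lemma cobound_killed N G i (c : {linear res N i.+1 -> G})
    (g : {linear res N i -> G}) k :
    finitely_generated N -> torsion G -> kills k c ->
    (forall y, c y = g (res_diff N i y)) ->
  exists (g' : {linear res N i -> G}) l,
    kills l g' /\ forall y, c y = g' (res_diff N i y).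
Proof.
move=> /(@fg_mod_free_syz _ i)/fg_mod_free_step Nf Gt ck cE.
move: Nf => [S [rho0 [ta [s' [rho' [rho0S rho's rho'E rta _]]]]]].
have [l lP] := kills_fg_image g Gt rho0S.
have [|f fE] := @cocycle_factor _ N G i.+1 c.
  by move=> y; rewrite cE res_diffK linear0.
exists ((g \o rho0) \+ (f \o ta)), (maxn k l); split=> [v va|y] /=.
  rewrite [g _](kills_le (leq_maxr k l) lP va) add0r.
  have : ta v \in powmod a _ k.
    by apply: powmod_img; apply: powmod_sub va; apply: leq_maxl.
  move=> /(powmod_surj (@aug_surj _ _))[w wk <-].
  by rewrite -fE ck.
rewrite fE {1}[aug _ y]rta linearD; congr (_ + _).
have [w wE] := aug_surj (rho' (aug (syz N i.+1) y)).
rewrite -wE -fE cE /=; congr (g _).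
by rewrite -[LHS]/(subm_val (aug (syz N i.+1) w)) wE rho'E.
Qed.

End FgUpToFree.

(** * Comparison of resolutions modulo powers of the ideal *)

Section TorsionCoefficients.
Variables (R : comNzRingType) (hR : noetherian R) (a : submodClosed R^o).
Implicit Types M C D V W X G : lmodType R.

Lemma powmodC V k (u v : V) : u - v \in powmod a V k -> v - u \in powmod a V k.
Proof. by move=> uv; rewrite -opprB -scaleN1r rpredZ. Qed.

(** Let D lie between M and C, with M -> D surjective with small kernel (as for
    C = M/a^k M and D = M/a^l M with l much larger than k). The maps h and h'
    are part of a chain map, up to an error in a^s, from the resolution of D to
    that of M lifting elements of D to M, and si is part of a homotopy, again up
    to a^s, between the canonical map to the resolution of C and its
    factorization through h. Only two consecutive degrees are recorded, and a
    larger power is asked for in degree n in order to get a^s in degree n + 1. *)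
Lemma approx_comparison M C (pi : {linear M -> C}) n s :
    finitely_generated M -> finitely_generated C ->
  exists t, forall D (pi' : {linear M -> D}) (psi : {linear D -> C}),
    (forall m, psi (pi' m) = pi m) -> (forall d, exists m, pi' m = d) ->
    (forall m, pi' m = 0 -> m \in powmod a M t) ->
  exists (h : {linear res D n -> res M n})
         (h' : {linear res D n.+1 -> res M n.+1})
         (si : {linear res D n -> res C n.+1}),
    (forall y, h (res_diff D n y) - res_diff M n (h' y)
                 \in powmod a (res M n) s) /\
    forall y, exists z,
      res_map psi n.+1 y - res_map pi n.+1 (h' y) - si (res_diff D n y)
        - res_diff C n.+1 z \in powmod a (res C n.+1) s.
Proof.
move=> Mfg Cfg; elim: n s => [|n IH] s.
  have [t0 t0P] := @res_approx_exact _ hR a C 0 s Cfg.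
  exists (maxn t0 s) => D pi' psi psiE pi's pi'k.
  have [|h hE] := @free_lift_exact _ _ _ _ (aug D) (pi' \o aug M).
    move=> d; have [m md] := pi's d; exists << m >>.
    by rewrite /= !augU.
  have hE' y : pi' (aug M (h y)) = aug D y by rewrite hE.
  have [|h' h'E] := @free_choose _ _ _ _ (h \o res_diff D 0) (res_diff M 0)
      (powmod a (res M 0) (maxn t0 s)).
    move=> w; apply: res_lift_mod; apply: pi'k.
    rewrite -[LHS]/(pi' (aug M (h (res_diff D 0 << w >>)))) hE'.
    exact: (@aug_res_diff _ D 0).
  have [|si siE] := @free_lift_exact _ _ _ _
      (res_map psi 0 \- (res_map pi 0 \o h)) (res_diff C 0).
    move=> d; apply: res_exact.
    by rewrite /= linearB !aug_map /= -psiE hE' subrr.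
  exists h, h', si; split=> y.
    exact: (powmod_sub (leq_maxr t0 s) (h'E y)).
  apply: t0P; rewrite !linearB -!res_map_diff -siE /= opprB addrC !addrA.
  rewrite subrK -linearB; apply: powmod_img.
  exact: (powmod_sub (leq_maxl t0 s) (h'E y)).
have [t0 t0P] := @res_approx_exact _ hR a C n.+1 s Cfg.
have [t1 t1P] := @res_approx_exact _ hR a M n (maxn t0 s) Mfg.
have [t tP] := IH (maxn t0 t1); exists t => D pi' psi psiE pi's pi'k.
have [h [h' [si [hE siE]]]] := tP D pi' psi psiE pi's pi'k.
have [|h2 h2E] := @free_choose _ _ _ _ (h' \o res_diff D n.+1)
    (res_diff M n.+1) (powmod a (res M n.+1) (maxn t0 s)).
  move=> w; apply: t1P => /=; have := hE (res_diff D n.+1 << w >>).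
  rewrite res_diffK linear0 => /powmodC; rewrite subr0.
  exact: (powmod_sub (leq_maxr t0 t1)).
have [|si2 si2E] := @free_choose _ _ _ _
    (res_map psi n.+1 \- (res_map pi n.+1 \o h') \- (si \o res_diff D n))
    (res_diff C n.+1) (powmod a (res C n.+1) (maxn t0 t1)).
  by move=> w; have [z zE] := siE << w >>; exists z.
exists h', h2, si2; split=> y; first exact: (powmod_sub (leq_maxr t0 s) (h2E y)).
(* The boundary of the defect in degree n.+2 is the error of si2 plus the image
   of the error of h2. *)
apply: t0P.
have : res_map psi n.+1 (res_diff D n.+1 y)
    - res_map pi n.+1 (h' (res_diff D n.+1 y))
    - si (res_diff D n (res_diff D n.+1 y))
    - res_diff C n.+1 (si2 (res_diff D n.+1 y))
      \in powmod a (res C n.+1) (maxn t0 t1) := si2E (res_diff D n.+1 y).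
rewrite res_diffK linear0 subr0 => /(powmod_sub (leq_maxl t0 t1)) H.
rewrite !linearB -!res_map_diff.
have /(powmod_sub (leq_maxl t0 s))/(powmod_img (res_map pi n.+1)) := h2E y.
move: H => /rpredD H /H; rewrite linearB /=.
by rewrite [X in X + _]addrAC addrA subrK addrAC.
Qed.

(** Once c and g are replaced by cochains killed by a^s, composing them with the
    approximate comparison maps gives exact equalities. So a class of
    Ext^{n+1}(C, G) that dies over M already dies over D. *)
Lemma torsion_Ext_injective M C (pi : {linear M -> C}) G n
    (c : {linear res C n.+1 -> G}) (g : {linear res M n -> G}) :
    finitely_generated M -> finitely_generated C -> torsion a G ->
    (forall y, c (res_diff C n.+1 y) = 0) ->
    (forall y, c (res_map pi n.+1 y) = g (res_diff M n y)) ->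
  exists t, forall D (pi' : {linear M -> D}) (psi : {linear D -> C}),
    (forall m, psi (pi' m) = pi m) -> (forall d, exists m, pi' m = d) ->
    (forall m, pi' m = 0 -> m \in powmod a M t) ->
  exists u : {linear res D n -> G},
    forall y, c (res_map psi n.+1 y) = u (res_diff D n y).
Proof.
move=> Mfg Cfg Gt c0 cg.
have [c1 [u1 [k [c1k cE]]]] := cocycle_killed hR Cfg Gt c0.
have c1d y : c1 (res_diff C n.+1 y) = 0.
  by have := c0 y; rewrite cE res_diffK linear0 addr0.
have c1k' : kills a k (c1 \o res_map pi n.+1).
  by move=> y yk /=; apply: c1k; apply: powmod_img.
have [|g' [l [g'l g'E]]] := cobound_killed (i := n) hR Mfg Gt c1k'
    (g := g \- (u1 \o res_map pi n)).
  move=> y /=; apply/eqP; rewrite -cg cE -res_map_diff addrK; exact/eqP.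
have [t tP] := approx_comparison pi n (maxn k l) Mfg Cfg.
exists t => D pi' psi psiE pi's pi'k.
have [h [h' [si [hE siE]]]] := tP D pi' psi psiE pi's pi'k.
(* c1 \o psi equals g' \o d \o h' up to c1 \o si \o d, and g' does not see the
   difference between d \o h' and h \o d. *)
exists ((g' \o h) \+ (c1 \o si) \+ (u1 \o res_map psi n)) => y /=.
rewrite cE -res_map_diff; congr (_ + _).
have [z /(powmod_sub (leq_maxl k l))/c1k] := siE y.
rewrite !linearB c1d subr0 => /eqP; rewrite subr_eq0 subr_eq => /eqP ->.
rewrite addrC; congr (_ + _); have := g'E (h' y) => /= ->.
apply/eqP; rewrite -subr_eq0 -linearB g'l//.
by apply: powmodC; exact: (powmod_sub (leq_maxr k l) (hE y)).
Qed.

End TorsionCoefficients.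

(** * Direct limits *)

Section SubquotientLemmas.
Variables (R : comNzRingType) (V : lmodType R) (S T : submodClosed V).

Lemma subquot_eqE (x y : subm S) :
  subquot_pi T x = subquot_pi T y <-> subm_val x - subm_val y \in T.
Proof.
split=> [/eqP|xy]; [|apply/eqP].
  by rewrite /subquot_pi quotm_eqE.
by rewrite /subquot_pi quotm_eqE.
Qed.

Lemma subquot_pi_surj (q : subquot S T) : exists x, q = subquot_pi T x.
Proof.
by exists (repr (q : quotm (trace S T))); rewrite /subquot_pi quotm_reprK.
Qed.

Lemma subquot_piP (r : R) (x y : subm S) :
  subquot_pi T (r *: x + y) = r *: subquot_pi T x + subquot_pi T y.
Proof. exact: (linearP (quotm_pi (trace S T))). Qed.

Lemma subquot_pi0 (x : subm S) : subquot_pi T x = 0 <-> subm_val x \in T.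
Proof.
have <- : subquot_pi T (0 : subm S) = 0 by exact: (linear0 (quotm_pi (trace S T))).
by split=> [/subquot_eqE|xT]; [rewrite subr0|apply/subquot_eqE; rewrite subr0].
Qed.

End SubquotientLemmas.

Section DirectLimit.
Variables (R : comNzRingType) (E : nat -> lmodType R).
Variables (f : forall k, E k -> E k.+1) (fl : forall k, linear (@f k)).

Lemma dinj_eq k (x : E k) : dinj x k = x.
Proof. exact: dfwithin. Qed.

Lemma dinj_neq k j (x : E k) : k != j -> dinj x j = 0.
Proof. exact: dfwithout. Qed.

Lemma dinjP k (r : R) (x y : E k) : dinj (r *: x + y) = r *: dinj x + dinj y.
Proof.
apply: dprod_ext => j; case: (eqVneq k j) => [<-|kj].
  by transitivity (r *: dinj x k + dinj y k); rewrite // !dinj_eq.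
transitivity (r *: dinj x j + dinj y j); last by [].
by rewrite !dinj_neq// scaler0 addr0.
Qed.

Lemma dinj0 k : dinj (0 : E k) = 0.
Proof. exact: (linear0 (mk_linear (@dinjP k))). Qed.

Lemma dinj_dsum k (x : E k) : dinj x \in dsum E.
Proof. by apply: span_mem; exists k, x. Qed.

Let rel : submodClosed (dprod E) := span [set s : dprod E |
  exists k (x : E k), s = dinj x - dinj (f x)]%classic.

Definition dl_in k (x : E k) : dirlim f := subquot_pi _ (Subm (dinj_dsum x)).

Lemma dl_inP k (r : R) (x y : E k) :
  dl_in (r *: x + y) = r *: dl_in x + dl_in y.
Proof.
rewrite /dl_in -subquot_piP; congr (subquot_pi _ _).
by apply: val_inj; rewrite /= dinjP.
Qed.

Lemma dl_in_step k (x : E k) : dl_in x = dl_in (f x).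
Proof. by apply/subquot_eqE; apply: span_mem; exists k, x. Qed.

Lemma dl_in_surj (v : dirlim f) :
  exists k0, forall k, (k0 <= k)%N -> exists x : E k, v = dl_in x.
Proof.
have [[s sd] ->] := subquot_pi_surj v.
suff H t : t \in dsum E -> exists k0, forall k, (k0 <= k)%N ->
    exists x : E k, t - dinj x \in rel.
  have [k0 k0P] := H s sd; exists k0 => k /k0P[x xP].
  by exists x; apply/subquot_eqE.
move: t; apply: span_ind => [r u v' [k kP] [l lP]||_ [k [x ->]]].
- exists (maxn k l) => m; rewrite geq_max => /andP[/kP[x xP] /lP[y yP]].
  exists (r *: x + y); rewrite dinjP opprD addrACA -scalerBr.
  by rewrite rpredD// rpredZ.
- exists 0%N => k _; exists 0.
  by rewrite dinj0 subr0 rpred0.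
- exists k => m /subnK <-; elim: (m - k)%N => [|j [y yP]].
    by exists x; rewrite subrr rpred0.
  exists (f y); rewrite -(subrK (dinj y) (dinj x)) -addrA rpredD//.
  by apply: span_mem; exists (j + k)%N, y.
Qed.

(** The image in E N of the components of s of index at most N. It detects when
    an element dies in the limit: it is linear and, for N large, kills each
    defining relation. *)
Fixpoint fold_to N (s : dprod E) : E N :=
  match N return E N with
  | 0 => s 0
  | M.+1 => f (fold_to M s) + s M.+1
  end.

Lemma f_lin0 k : f (0 : E k) = 0.
Proof. exact: (linear0 (mk_linear (@fl k))). Qed.

Lemma fold_toP N r (s t : dprod E) :
  fold_to N (r *: s + t) = r *: fold_to N s + fold_to N t.
Proof.
elim: N => [//|N IH] /=.
by rewrite IH fl [(_ + _ : dprod E) _]/(r *: s N.+1 + t N.+1) scalerDr addrACA.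
Qed.

Lemma fold_to_lt N k (x : E k) : (N < k)%N -> fold_to N (dinj x) = 0.
Proof.
elim: N => [|N IH] Nk /=; first by rewrite dinj_neq// -lt0n.
by rewrite IH ?(ltnW Nk)// f_lin0 add0r dinj_neq// neq_ltn Nk orbT.
Qed.

Lemma fold_to_eq k (y : E k) : fold_to k (dinj y) = y.
Proof.
case: k y => [|k] y /=; first exact: dinj_eq.
by rewrite fold_to_lt// f_lin0 add0r dinj_eq.
Qed.

Lemma fold_to_dinj k (x : forall j, E (j + k)) :
    (forall j, x j.+1 = f (x j)) ->
  forall j, fold_to (j + k) (dinj (x 0%N : E k)) = x j.
Proof.
move=> xS; elim=> [|j IH]; last first.
  transitivity (f (fold_to (j + k) (dinj (x 0%N : E k)))
                + dinj (x 0%N : E k) (j + k).+1); first by [].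
  rewrite dinj_neq; first by rewrite IH addr0 xS.
  by rewrite neq_ltn ltnS leq_addl.
exact: (fold_to_eq (x 0%N : E k)).
Qed.

Lemma fold_to_rel l (y : E l) M :
  (l < M)%N -> fold_to M (dinj y) = fold_to M (dinj (f y)).
Proof.
elim: M => // M IH; rewrite ltnS leq_eqVlt => /orP[/eqP lM|lM].
  case: M / lM {IH}; rewrite fold_to_eq.
  transitivity (f (fold_to l (dinj y)) + dinj y l.+1); first by [].
  by rewrite fold_to_eq dinj_neq ?addr0// neq_ltn ltnSn.
transitivity (f (fold_to M (dinj y)) + dinj y M.+1); first by [].
transitivity (f (fold_to M (dinj (f y))) + dinj (f y) M.+1); last by [].
have ly : l != M.+1 by rewrite neq_ltn (leqW lM).
have ly' : l.+1 != M.+1 by rewrite neq_ltn ltnS lM.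
by rewrite (IH lM) (dinj_neq _ ly) (dinj_neq _ ly').
Qed.

(** The successive images of x 0 are given as a family x indexed by the number of
    steps, so that they live in E (j + k) by computation, without casts. *)
Lemma dl_in0 k (x : forall j, E (j + k)) : (forall j, x j.+1 = f (x j)) ->
  dl_in (x 0%N : E k) = 0 <-> exists j, x j = 0.
Proof.
move=> xS; split=> [/subquot_pi0/= x0|[j xj0]]; last first.
  have xE i : dl_in (x 0%N : E k) = dl_in (x i).
    by elim: i => [//|i IH]; rewrite IH dl_in_step -xS.
  by rewrite (xE j) xj0; apply/subquot_pi0; rewrite /= dinj0 rpred0.
have : exists N, forall M, (N <= M)%N -> fold_to M (dinj (x 0%N : E k)) = 0.
  move: (dinj _) x0; apply: span_ind => [r s t [N sN] [M tM]||_ [l [y ->]]].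
  - exists (maxn N M) => m; rewrite geq_max => /andP[/sN s0 /tM t0].
    by rewrite fold_toP s0 t0 scaler0 addr0.
  - by exists 0%N => M _; apply: (linear0 (mk_linear (@fold_toP M))).
  - exists l.+1 => M lM; rewrite addrC -scaleN1r fold_toP scaleN1r addrC.
    by rewrite (fold_to_rel y lM) subrr.
move=> [N NP]; exists N; rewrite -fold_to_dinj//; apply: NP.
exact: leq_addr.
Qed.

End DirectLimit.

(** * Cocycles representing Ext and local cohomology classes *)

Section FreeFunctoriality.
Variable R : comNzRingType.
Implicit Types U V W N : lmodType R.

Lemma res_map_id V (f : {linear V -> V}) i : f =1 id -> res_map f i =1 id.
Proof.
move=> fid y; suff fE : syz_map f i =1 id.
  by apply: (@free_ext _ _ _ (res_map f i) idfun) => v /=; rewrite free_liftU fE.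
elim: i {y} => [//|i IH] x /=; apply: val_inj => /=.
by apply: (@free_ext _ _ _ (free_map (syz_map f i)) idfun) => v /=;
  rewrite free_liftU IH.
Qed.

Lemma res_map_comp U V W (f : {linear U -> V}) (g : {linear V -> W})
    (h : {linear U -> W}) i :
  (forall u, h u = g (f u)) ->
  forall y, res_map h i y = res_map g i (res_map f i y).
Proof.
move=> hE; suff hE' u : syz_map h i u = syz_map g i (syz_map f i u).
  move=> y.
  apply: (@free_ext _ _ _ (res_map h i) (res_map g i \o res_map f i)) => v /=.
  by rewrite !free_liftU hE'.
elim: i u => [//|i IH] u /=; apply: val_inj => /=.
apply: (@free_ext _ _ _ (free_map (syz_map h i))
  (free_map (syz_map g i) \o free_map (syz_map f i))) => v /=.
by rewrite !free_liftU IH.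
Qed.

End FreeFunctoriality.

Section ExtClasses.
Variables (R : comNzRingType).
Implicit Types M N P X : lmodType R.

Lemma coboundS N X i (c : res N i.+1 -> X) :
  c \in coboundary N X i.+1 <->
  exists g : {linear res N i -> X}, forall y, c y = g (res_diff N i y).
Proof.
split=> [/asboolP[g ->]|[g gE]]; first by exists g.
by apply/asboolP; exists g; apply/funext.
Qed.

Lemma cobound0 N X (c : res N 0 -> X) :
  c \in coboundary N X 0 <-> forall y, c y = 0.
Proof.
split=> [/eqP ->//|c0]; by apply/eqP/funext.
Qed.

Lemma cocycleP N X i (c : {linear res N i -> X}) :
  (c : res N i -> X) \in cocycle N X i <-> forall y, c (res_diff N i y) = 0.
Proof.
split=> [/asboolP[]//|c0]; apply/asboolP; split=> // r x y; exact: linearP.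
Qed.

(** Classes are handled through representing cocycles, which are plain functions
    here so that equality of representatives is pointwise. *)
Definition ext_class i N X (c : res N i -> X) (e : Ext i N X) :=
  exists H : c \in cocycle N X i, e = subquot_pi _ (Subm H).

Lemma ext_class_surj i N X (e : Ext i N X) :
  exists c : {linear res N i -> X}, ext_class c e.
Proof.
have [[c H] ->] := subquot_pi_surj e; have /asboolP[cl _] := H.
by exists (mk_linear cl), H.
Qed.

Lemma ext_class_ex i N X (c : {linear res N i -> X}) :
  (forall y, c (res_diff N i y) = 0) -> exists e : Ext i N X, ext_class c e.
Proof. by move=> /cocycleP H; exists (subquot_pi _ (Subm H)), H. Qed.

Lemma ext_class_cocycle i N X (c : {linear res N i -> X}) (e : Ext i N X) :
  ext_class c e -> forall y, c (res_diff N i y) = 0.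
Proof. by case=> H _; apply/cocycleP. Qed.

Lemma ext_class_linear i N X r (c d : res N i -> X) (e h : Ext i N X) :
  ext_class c e -> ext_class d h ->
  ext_class (fun y => r *: c y + d y) (r *: e + h).
Proof.
move=> [Hc ->] [Hd ->].
have H : (fun y => r *: c y + d y) \in cocycle N X i.
  exact: (rpredD (rpredZ r Hc) Hd).
exists H; rewrite -subquot_piP; congr (subquot_pi _ _); exact: val_inj.
Qed.

Lemma ext_class0 i N X (c : res N i -> X) (e : Ext i N X) :
  ext_class c e -> e = 0 <-> c \in coboundary N X i.
Proof. by move=> [H ->]; exact: subquot_pi0. Qed.

Lemma ext_class_map i M N X (f : {linear M -> N}) (c : res N i -> X)
    (e : Ext i N X) :
  ext_class c e -> ext_class (c \o res_map f i) (Ext_map f e).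
Proof.
move=> [H ->]; exists (cocycle_map_subproof f (Subm H)).
by rewrite Ext_mapE; congr (subquot_pi _ _); apply: val_inj.
Qed.

Lemma ext_class_inj i N X (c : res N i -> X) (e h : Ext i N X) :
  ext_class c e -> ext_class c h -> e = h.
Proof.
by move=> [H ->] [H' ->]; congr (subquot_pi _ _); apply: val_inj.
Qed.

Lemma Ext_map_linear i M N X (f : {linear M -> N}) : linear (@Ext_map R M N X f i).
Proof.
move=> r u v; have [[c cu] [d dv]] := (ext_class_surj u, ext_class_surj v).
have h := ext_class_map f (ext_class_linear r cu dv).
apply: ext_class_inj h _.
exact: (ext_class_linear r (ext_class_map f cu) (ext_class_map f dv)).
Qed.

Lemma Ext_map_id i N X (f : {linear N -> N}) (e : Ext i N X) :
  f =1 id -> Ext_map f e = e.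
Proof.
move=> fid; have [c ce] := ext_class_surj e.
apply: ext_class_inj (ext_class_map f ce) _.
suff -> : c \o res_map f i = c by [].
by apply/funext => y /=; rewrite res_map_id.
Qed.

Lemma Ext_map_comp i M N P X (f : {linear M -> N}) (g : {linear N -> P})
    (h : {linear M -> P}) (e : Ext i P X) :
  (forall m, h m = g (f m)) -> Ext_map h e = Ext_map f (Ext_map g e).
Proof.
move=> hE; have [c ce] := ext_class_surj e.
apply: ext_class_inj (ext_class_map h ce) _.
suff -> : c \o res_map h i = c \o res_map g i \o res_map f i.
  by do 2! apply: ext_class_map.
by apply/funext => y /=; rewrite (res_map_comp hE).
Qed.

End ExtClasses.

Section LocalCohomologyClasses.
Variables (R : comNzRingType) (a : submodClosed R^o) (M : lmodType R).
Implicit Types (X : lmodType R) (k l : nat).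

Definition powquot k : lmodType R := quotm (powmod a M k).

Definition powquot_pi k : {linear M -> powquot k} := quotm_pi (powmod a M k).

Definition powquot_proj k l (kl : (k <= l)%N) :
  {linear powquot l -> powquot k} := quotm_projL (powmod_sub kl).

Lemma powquot_projE k l (kl : (k <= l)%N) m :
  powquot_proj kl (powquot_pi l m) = powquot_pi k m.
Proof. exact: (quotm_projE (powmod_sub kl) m). Qed.

Lemma powquot_stepE k m :
  quotm_projL (@powmodS_sub R a M k) (powquot_pi k.+1 m) = powquot_pi k m.
Proof. exact: (quotm_projE (@powmodS_sub R a M k) m). Qed.

Lemma powquot_pi_surj k (q : powquot k) : exists m, powquot_pi k m = q.
Proof. by exists (repr q); apply: quotm_reprK. Qed.

Lemma powquot_pi0 k m : powquot_pi k m = 0 -> m \in powmod a M k.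
Proof.
by move/eqP; rewrite -(linear0 (powquot_pi k)) quotm_eqE subr0.
Qed.

Definition glc_class n X k (c : res (powquot k) n -> X)
    (v : gen_local_cohomology a n M X) :=
  exists2 e : Ext n (powquot k) X, ext_class c e & v = dl_in _ e.

Variables (n : nat).

Lemma glc_class_surj X (v : gen_local_cohomology a n M X) :
  exists k0, forall k, (k0 <= k)%N ->
    exists c : {linear res (powquot k) n -> X}, glc_class c v.
Proof.
have [k0 k0P] := dl_in_surj v; exists k0 => k /k0P[e ->].
by have [c ce] := ext_class_surj e; exists c, e.
Qed.

Lemma glc_class_ex X k (c : {linear res (powquot k) n -> X}) :
  (forall y, c (res_diff _ n y) = 0) ->
  exists v : gen_local_cohomology a n M X, glc_class c v.
Proof. by move=> /ext_class_ex[e ce]; exists (dl_in _ e), e. Qed.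

Lemma glc_class_cocycle X k (c : {linear res (powquot k) n -> X})
    (v : gen_local_cohomology a n M X) :
  glc_class c v -> forall y, c (res_diff _ n y) = 0.
Proof. by move=> [e /ext_class_cocycle]. Qed.

Lemma glc_class_linear X k r (c d : res (powquot k) n -> X)
    (v w : gen_local_cohomology a n M X) :
  glc_class c v -> glc_class d w ->
  glc_class (fun y => r *: c y + d y) (r *: v + w).
Proof.
move=> [e ce ->] [h dh ->]; exists (r *: e + h); last by rewrite dl_inP.
exact: ext_class_linear.
Qed.

Lemma glc_class_proj X k l (kl : (k <= l)%N) (c : res (powquot k) n -> X)
    (v : gen_local_cohomology a n M X) :
  glc_class c v -> glc_class (c \o res_map (powquot_proj kl) n) v.
Proof.
move=> [e ce ->]; exists (Ext_map (powquot_proj kl) e).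
  exact: ext_class_map.
have [j lE] : exists j, l = (j + k)%N by exists (l - k)%N; rewrite subnK.
subst l; elim: j kl => [|j IH] kl.
  rewrite Ext_map_id// => q; have [m <-] := powquot_pi_surj q.
  exact: powquot_projE.
rewrite (IH (leq_addl j k)) dl_in_step; congr dl_in.
rewrite -(@Ext_map_comp _ _ _ _ _ _ _ _ (powquot_proj kl))// => q.
have [m <-] := powquot_pi_surj q.
by rewrite powquot_projE (powquot_stepE (j + k)) powquot_projE.
Qed.

(** The exactness of direct limits, at the level of cocycles. *)
Lemma glc_class0 X k (c : res (powquot k) n -> X)
    (v : gen_local_cohomology a n M X) :
  glc_class c v -> v = 0 <-> exists l (kl : (k <= l)%N),
    c \o res_map (powquot_proj kl) n \in coboundary (powquot l) X n.
Proof.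
move=> cv; split=> [v0|[l [kl cl]]]; last first.
  have [e ce ->] := glc_class_proj kl cv.
  move: cl => /(ext_class0 ce) ->; exact: (linear0 (mk_linear (@dl_inP _ _ _ l))).
have [e ce vE] := cv.
pose x j : Ext n (powquot (j + k)) X := Ext_map (powquot_proj (leq_addl j k)) e.
have xS j : x j.+1 = Ext_map (quotm_projL (@powmodS_sub R a M (j + k)%N)) (x j).
  rewrite /x -(@Ext_map_comp _ _ _ _ _ _ _ _ (powquot_proj (leq_addl j.+1 k)))//.
  move=> q; have [m <-] := powquot_pi_surj q.
  by rewrite powquot_projE (powquot_stepE (j + k)) powquot_projE.
have x0 : x 0%N = e.
  by apply: Ext_map_id => q; have [m <-] := powquot_pi_surj q; apply: powquot_projE.
have [] := dl_in0 (fun k => Ext_map_linear (quotm_projL (@powmodS_sub R a M k))) xS.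
rewrite x0 -vE => /(_ v0)[j xj0] _; exists (j + k)%N, (leq_addl j k).
exact/(ext_class0 (ext_class_map _ ce)).
Qed.

End LocalCohomologyClasses.

(** * Length along linear relations *)

Section Length.
Variable R : comNzRingType.
Implicit Types A B C V W X M : lmodType R.

Definition length_le V n := forall m, has_chain V m -> (m <= n)%N.

Lemma mod_length_max V : finite_length V ->
  has_chain V (mod_length V) /\ length_le V (mod_length V).
Proof.
move=> [n nP]; rewrite /mod_length; case: xgetP => [m _ [Hm mP] //|noP].
pose P m := `[< has_chain V m >].
have P0 : exists m, P m by exists 0%N; apply/asboolP; exists (fun=> full V).
have Pn m : P m -> (m <= n)%N by move=> /asboolP/nP.
case: (ex_maxnP P0 Pn) => m /asboolP Hm mP; case: (noP m); split=> // l Hl.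
exact/mP/asboolP.
Qed.

Lemma finite_length_le V n :
  length_le V n -> finite_length V /\ (mod_length V <= n)%N.
Proof.
move=> Vn; have fV : finite_length V by exists n.
by split=> //; apply: Vn; case: (mod_length_max fV).
Qed.

Definition jump V (T : nat -> submodClosed V) i : bool :=
  `[< exists2 x, x \in T i.+1 & x \notin T i >].

(** Erasing the repetitions of a weakly increasing sequence. *)
Lemma chain_of_jumps V (T : nat -> submodClosed V) m :
    (forall i, (i < m)%N -> {subset T i <= T i.+1}) ->
  has_chain V (\sum_(i < m) jump T i).
Proof.
move=> Tm; suff [S [SP _]] : exists S : nat -> submodClosed V,
    (forall i, (i < \sum_(i < m) jump T i)%N ->
      {subset S i <= S i.+1} /\ exists2 x, x \in S i.+1 & x \notin S i) /\
    {subset S (\sum_(i < m) jump T i)%N <= T m} by exists S.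
elim: m Tm => [|m IH] Tm; first by exists (fun=> T 0%N); rewrite big_ord0; split.
have [i im|S [SP STm]] := IH; first exact/Tm/leqW.
rewrite big_ord_recr /=; case: (boolP (jump T m)) => [/asboolP[x xT xnT]|_].
  rewrite addn1; set p := (\sum_(i < m) _)%N in SP STm *.
  exists (fun i => if (i <= p)%N then S i else T m.+1); rewrite ltnn; split=> //.
  move=> i; rewrite ltnS leq_eqVlt => /orP[/eqP ->|ip].
    rewrite eqxx ltnn; split=> [y /STm/Tm|]; first exact.
    by exists x => //; apply: contra xnT => /STm.
  by rewrite ip orbT; apply: SP.
rewrite addn0; exists S; split=> // y /STm/Tm; exact.
Qed.

(** Maps between the cohomology modules come as relations between classes of
    cocycles; the bounds on lengths can be read off these relations without
    making choices. *)
Definition linear_rel V W (Q : V -> W -> Prop) :=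
  forall (r : R) v w v' w', Q v w -> Q v' w' -> Q (r *: v + v') (r *: w + w').

Lemma linear_relB V W (Q : V -> W -> Prop) v w v' w' :
  linear_rel Q -> Q v w -> Q v' w' -> Q (v - v') (w - w').
Proof.
move=> QD vw vw'; rewrite [v - v']addrC [w - w']addrC -!scaleN1r.
exact: QD.
Qed.

(** Subadditivity of the length on A -> B -> C, exact in the middle. A strict
    inclusion in B must remain strict after taking preimages in A or images in
    C. *)
Lemma length_exact A B C (Q : A -> B -> Prop) (Q' : B -> C -> Prop) p q :
    linear_rel Q -> linear_rel Q' ->
    (forall b, Q 0 b -> b = 0) -> (forall b, exists c, Q' b c) ->
    (forall b, Q' b 0 -> exists x, Q x b) ->
  length_le A p -> length_le C q -> length_le B (p + q).
Proof.
move=> Ql Ql' Q0 Q's Q'k Ap Cq m [S SP].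
have Q'00 : Q' 0 0.
  by have [c c0] := Q's 0; have := linear_relB Ql' c0 c0; rewrite !subrr.
have Q00 : Q 0 0.
  by have [x x0] := Q'k 0 Q'00; have := linear_relB Ql x0 x0; rewrite !subrr.
have /choice[F FP] i : exists F : submodClosed A, forall x, x \in F <->
    exists2 b, b \in S i & Q x b.
  apply: prop_submod => [r x y [b bS xb] [c cS yc]|]; last first.
    by exists 0; [exact: rpred0|].
  by exists (r *: b + c); [rewrite rpredD ?rpredZ|apply: Ql].
have /choice[G GP] i : exists G : submodClosed C, forall x, x \in G <->
    exists2 b, b \in S i & Q' b x.
  apply: prop_submod => [r x y [b bS xb] [c cS yc]|]; last first.
    by exists 0; [exact: rpred0|].
  by exists (r *: b + c); [rewrite rpredD ?rpredZ|apply: Ql'].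
have Fm i : (i < m)%N -> {subset F i <= F i.+1}.
  by move=> /SP[SS _] x /FP[b /SS bS xb]; apply/FP; exists b.
have Gm i : (i < m)%N -> {subset G i <= G i.+1}.
  by move=> /SP[SS _] x /GP[b /SS bS xb]; apply/GP; exists b.
apply: leq_trans (leq_add (Ap _ (chain_of_jumps Fm)) (Cq _ (chain_of_jumps Gm))).
rewrite -big_split /= -[X in (X <= _)%N]card_ord -sum1_card leq_sum//.
move=> -[i im] _ /=.
case: (boolP (jump G i)) => [_|/asboolPn nG]; first by rewrite addn1.
case: (boolP (jump F i)) => [//|/asboolPn nF].
have [SS [b bS bnS]] := SP i im; case/negP: bnS.
have [c bc] := Q's b.
have /GP[b1 b1S b1c] : c \in G i.
  by apply: contrapT => /negP cG; apply: nG; exists c => //; apply/GP; exists b.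
have [|x xb] := Q'k (b - b1).
  by rewrite -(subrr c); apply: linear_relB.
have /FP[b2 b2S xb2] : x \in F i.
  apply: contrapT => /negP xF; apply: nF; exists x => //; apply/FP.
  by exists (b - b1) => //; apply: submodB => //; apply: SS.
have /eqP : b - b1 - b2 = 0.
  by apply: Q0; rewrite -(subrr x); apply: linear_relB.
by rewrite !subr_eq0 subr_eq => /eqP ->; rewrite rpredD.
Qed.

Let triv : lmodType R := subm (span (set0 : set R^o)).

Lemma triv_length : length_le triv 0.
Proof.
case=> // m [S /(_ 0%N isT)[_ [x _]]].
suff -> : x = 0 by rewrite rpred0.
apply: val_inj; case: x => x /= xs.
by apply: (@span_ind _ _ (fun x => x = 0)) xs => // r u v -> ->;
  rewrite scaler0 addr0.
Qed.

Lemma length_injective B C (Q : B -> C -> Prop) n :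
    linear_rel Q -> (forall b, exists c, Q b c) -> (forall b, Q b 0 -> b = 0) ->
  length_le C n -> length_le B n.
Proof.
move=> Ql Qs Q0; apply: (@length_exact triv B C (fun _ b => b = 0) Q 0 n) => //.
- by move=> r _ v _ v' -> ->; rewrite scaler0 addr0.
- by move=> b /Q0; exists 0.
- exact: triv_length.
Qed.

Lemma length_surjective A B (Q : A -> B -> Prop) n :
    linear_rel Q -> (forall b, Q 0 b -> b = 0) -> (forall b, exists x, Q x b) ->
  length_le A n -> length_le B n.
Proof.
move=> Ql Q0 Qs An; rewrite -(addn0 n).
apply: (@length_exact A B triv Q (fun _ c => c = 0)) => //.
- by move=> r _ v _ v' -> ->; rewrite scaler0 addr0.
- by exists 0.
- exact: triv_length.
Qed.

Lemma linear_rel_iso V W (Q : V -> W -> Prop) :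
    linear_rel Q -> (forall v, exists w, Q v w) -> (forall w, exists v, Q v w) ->
    (forall w, Q 0 w -> w = 0) -> (forall v, Q v 0 -> v = 0) ->
  exists (f : {linear V -> W}) (g : {linear W -> V}), cancel f g /\ cancel g f.
Proof.
move=> Ql /choice[f fQ] Qsurj Qf Qi.
have fE v w : Q v w -> w = f v.
  move=> vw; apply/eqP; rewrite -subr_eq0; apply/eqP/Qf.
  by rewrite -(subrr v); apply: linear_relB.
have fl : linear f.
  by move=> r u v; apply/esym/fE; apply: Ql.
have [v fv0|w|g [fg gf]] := @linear_inverse _ _ _ (mk_linear fl).
- by apply: Qi; have := fQ v; rewrite [f v]fv0.
- by have [v /fE wv] := Qsurj w; exists v.
by exists (mk_linear fl), g.
Qed.

Lemma length_Ext_iso p M V W (f : {linear V -> W}) (g : {linear W -> V}) n :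
    cancel g f -> length_le (Ext p M V) n -> length_le (Ext p M W) n.
Proof.
move=> gK; pose Q (w : Ext p M W) (v : Ext p M V) :=
  exists2 c : {linear res M p -> W}, ext_class c w & ext_class (g \o c) v.
apply: (@length_injective _ _ Q).
- move=> r v w v' w' [c cv gcw] [d dv gdw].
  exists (r \*: c \+ d); first exact: ext_class_linear.
  have -> : g \o (r \*: c \+ d : {linear _ -> _}) =
      (fun y => r *: (g \o c) y + (g \o d) y).
    by apply/funext => y /=; rewrite linearP.
  exact: ext_class_linear.
- move=> w; have [c cw] := ext_class_surj w.
  have [|v vP] := @ext_class_ex _ p M V (g \o c).
    by move=> y /=; rewrite (ext_class_cocycle cw) linear0.
  by exists v, c.
- move=> w [c cw /ext_class0 [/(_ erefl) gc _]].
  apply/(ext_class0 cw); case: p c gc {cw w Q} => [|p] c.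
    by move=> /cobound0 gc; apply/cobound0 => y; rewrite -[c y]gK [g _]gc linear0.
  move=> /coboundS[u uE]; apply/coboundS; exists (f \o u) => y /=.
  by rewrite -uE /= gK.
Qed.

End Length.

(** * Localization and the effacing module *)

Section Localization.
Variables (R : comNzRingType).
Implicit Types (X W N : lmodType R) (x r : R).

Definition inverts r W :=
  (forall w : W, r *: w = 0 -> w = 0) /\ forall w : W, exists w', r *: w' = w.

Lemma invertsX r W k : inverts r W -> inverts (r ^+ k) W.
Proof.
move=> [r0 rs]; elim: k => [|k [IH0 IHs]].
  by rewrite expr0; split=> w; [rewrite scale1r|exists w; rewrite scale1r].
split=> w; first by rewrite exprS -scalerA => /r0/IH0.
have [w1 <-] := rs w; have [w2 <-] := IHs w1.
by exists w2; rewrite exprS -scalerA.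
Qed.

(** Ext(N, W) is killed by r because N is, while r acts bijectively on it because
    it does on W. *)
Lemma inverted_cobound N W r i (c : {linear res N i -> W}) :
    (forall v : N, r *: v = 0) -> inverts r W ->
    (forall y, c (res_diff N i y) = 0) ->
  (c : res N i -> W) \in coboundary N W i.
Proof.
move=> rN [r0 rs]; case: i c => [|i] c c0.
  have [f fE] := cocycle_factor c0; apply/cobound0 => y; apply: r0.
  by rewrite -linearZ fE linearZ /= rN linear0.
have [v|u uE] := @scale_cobound _ N W r \0 i c _ c0; first by rewrite linear0 rN.
have [v|u' u'E] := @free_lift_exact _ _ _ _ u (r \*: (idfun : {linear W -> W})).
  by have [w] := rs (u << v >>); exists w.
apply/coboundS; exists u' => y; apply/eqP; rewrite -subr_eq0; apply/eqP/r0.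
by rewrite scalerBr uE u'E subrr.
Qed.

(** The localization X_x is taken as the direct limit of X -> X -> X -> ... with
    all maps the multiplication by x. *)
Definition loc_step x X (k : nat) (v : X) : X := x *: v.

Definition loc x X : lmodType R := dirlim (E := fun=> X) (@loc_step x X).

Lemma loc_step_linear x X k : linear (@loc_step x X k).
Proof. by move=> r u v; rewrite /loc_step scalerDr !scalerA mulrC. Qed.

Definition loc_in x X k (v : X) : loc x X := @dl_in _ _ (@loc_step x X) k v.

Lemma loc_in_linear x X k : linear (@loc_in x X k).
Proof. by move=> r u v; apply: dl_inP. Qed.

Lemma loc_inZ x X k r (v : X) : loc_in x k (r *: v) = r *: loc_in x k v.
Proof. exact: (linearZ_LR (mk_linear (@loc_in_linear x X k))). Qed.

Lemma loc_in0 x X k (v : X) : loc_in x k v = 0 <-> exists j, x ^+ j *: v = 0.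
Proof.
have := @dl_in0 _ _ _ (@loc_step_linear x X) k (fun j => x ^+ j *: v).
rewrite /= expr0 scale1r; apply => j.
by rewrite exprS -scalerA.
Qed.

Lemma loc_inverts x X : inverts x (loc x X).
Proof.
split=> w; have [k /(_ k (leqnn k))[v ->]] := dl_in_surj w.
  rewrite -[dl_in _ v]/(loc_in x k v) -loc_inZ => /loc_in0[j].
  by rewrite scalerA -exprSr => xv; apply/(@loc_in0 x X k); exists j.+1.
exists (loc_in x k.+1 v).
rewrite -loc_inZ.
exact/esym/(@dl_in_step _ _ (@loc_step x X)).
Qed.

Variable a : submodClosed R^o.

(** E is the product of the localizations of X at generators of a. For uniformity
    the product runs over all natural numbers: past the last generator the
    element inverted is 0, and the factor vanishes. *)
Lemma exists_effacement (hR : noetherian R) X :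
  exists (E : lmodType R) (e : {linear X -> E}),
    (forall v, e v = 0 <-> exists k, forall r, r \in ideal_exp a k -> r *: v = 0)
    /\ forall N k, (forall r (v : N), r \in ideal_exp a k -> r *: v = 0) ->
       forall i (c : {linear res N i -> E}),
       (forall y, c (res_diff N i y) = 0) ->
       (c : res N i -> E) \in coboundary N E i.
Proof.
have [xs xsa] := hR a.
pose x k : R := nth (0 : R^o) xs k.
have xa k : x k \in a.
  rewrite /x -xsa; case: (ltnP k (size xs)) => [ks|sk].
    by apply/span_mem/mem_nth.
  by rewrite nth_default// rpred0.
pose E : lmodType R := dprod (fun k => loc (x k) X).
have el : linear (fun v : X => (fun k => loc_in (x k) 0 v) : E).
  by move=> r u v; apply: dprod_ext => k; rewrite loc_in_linear.
exists E, (mk_linear el); split=> [v|N k aN i c c0].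
  have e0 : mk_linear el v = 0 <-> forall k, loc_in (x k) 0 v = 0.
    split=> [H k|H]; last exact: dprod_ext.
    exact: (f_equal (fun s : dprod (fun k => loc (x k) X) => s k) H).
  rewrite e0; split=> [vx|[t tP] k]; last first.
    by apply/loc_in0; exists t; apply/tP/ideal_expX.
  have [J JE] : exists J : submodClosed R^o,
      forall r : R, r \in J <-> r *: v = 0.
    apply: (@prop_submod _ R^o (fun r : R => r *: v = 0)) => [r p q p0 q0|].
      by rewrite scalerDl -scalerA p0 q0 scaler0 addr0.
    by rewrite scale0r.
  have [y yxs|t tJ] := @ideal_exp_subset_gen R xs J.
    have /loc_in0[j yj] := vx (index y xs).
    by exists j; apply/JE; rewrite /x nth_index in yj.
  by exists t => r; rewrite -(ideal_exp_eq t xsa) => /tJ/JE.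
have cl k' : linear (fun y => (c y : dprod (fun k => loc (x k) X)) k').
  by move=> r u v; rewrite linearP.
pose ck k' : {linear res N i -> loc (x k') X} := mk_linear (cl k').
have ckb k' : (fun y => (c y : dprod (fun k => loc (x k) X)) k')
    \in coboundary N (loc (x k') X) i.
  rewrite -[X in X \in _]/(ck k' : res N i -> _).
  apply: (@inverted_cobound _ _ (x k' ^+ k)).
  - by move=> v; apply/aN/ideal_expX.
  - exact/invertsX/loc_inverts.
  - move=> y.
    exact: (f_equal (fun s : dprod (fun k => loc (x k) X) => s k') (c0 y)).
case: i c c0 {cl ck} ckb => [|i] c c0 ckb.
  apply/cobound0 => y; apply: dprod_ext => k'.
  exact: (proj1 (@cobound0 _ _ _ _) (ckb k') y).
have uex k' : exists u : {linear res N i -> loc (x k') X},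
  forall y, (c y : dprod (fun k => loc (x k) X)) k' = u (res_diff N i y).
  exact/coboundS/ckb.
pose u k' := projT1 (cid (uex k')).
have ul : linear (fun y : res N i => (fun k' => u k' y) : E).
  by move=> r y z; apply: dprod_ext => k'; rewrite linearP.
apply/coboundS; exists (mk_linear ul) => y; apply: dprod_ext => k'.
exact: (projT2 (cid (uex k'))).
Qed.

End Localization.

(** * Torsion coefficients and the connecting sequence *)

Section ConnectingSequence.
Variables (R : comNzRingType) (hR : noetherian R) (a : submodClosed R^o).
Implicit Types (M N V W G : lmodType R).

Lemma cobound_comp N V W i (f : {linear V -> W}) (c : res N i -> V) :
  c \in coboundary N V i -> f \o c \in coboundary N W i.
Proof.
case: i c => [|i] c.
  by move=> /cobound0 c0; apply/cobound0 => y /=; rewrite c0 linear0.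
move=> /coboundS[g gE]; apply/coboundS; exists (f \o g) => y /=.
by rewrite gE.
Qed.

Lemma glc_class_cohomologous M W n k (c c' : res (powquot a M k) n.+1 -> W)
    (u : {linear res (powquot a M k) n -> W}) v :
    (forall y, c' y = c y + u (res_diff (powquot a M k) n y)) ->
  glc_class c v -> glc_class c' v.
Proof.
move=> c'E cv.
pose d i := res_diff (powquot a M k) i.
have [|w uw] := @glc_class_ex _ a M n.+1 W k (u \o d n).
  by move=> y; rewrite -[LHS]/(u (d n (d n.+1 y))) res_diffK linear0.
have w0 : w = 0.
  apply/(glc_class0 uw); exists k, (leqnn k).
  apply/coboundS; exists (u \o res_map (powquot_proj a M (leqnn k)) n) => y.
  rewrite -[RHS]/(u (res_map _ n (res_diff (powquot a M k) n y))).
  by rewrite res_map_diff.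
have := glc_class_linear 1 cv uw; rewrite w0 addr0 scale1r.
suff <- : c' = (fun y => 1 *: c y + (u \o res_diff (powquot a M k) n) y) by [].
by apply/funext => y; rewrite scale1r c'E.
Qed.

Lemma fg_powquot M k : finitely_generated M -> finitely_generated (powquot a M k).
Proof.
move=> [s sE]; exists (map (powquot_pi a M k) s) => q.
have [m <-] := powquot_pi_surj q.
by rewrite (span_img (powquot_pi a M k)) ?sE.
Qed.

(** [torsion_Ext_injective] for M -> M/a^l M -> M/a^k M with l large. This is the
    injectivity of T^n(M, G) -> Ext^n(M, G), on representatives. *)
Lemma glc_kernel_torsion M G n k (c : {linear res (powquot a M k) n -> G}) :
    finitely_generated M -> torsion a G ->
    (forall y, c (res_diff (powquot a M k) n y) = 0) ->
    c \o res_map (powquot_pi a M k) n \in coboundary M G n ->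
  exists l (kl : (k <= l)%N),
    c \o res_map (powquot_proj a M kl) n \in coboundary (powquot a M l) G n.
Proof.
move=> Mfg Gt; case: n c => [|n] c c0.
  (* A cocycle of degree 0 is a linear map on M/a^k M, and M maps onto it. *)
  move=> /cobound0 cpi; exists k, (leqnn k); apply/cobound0 => y /=.
  have [f fE] := cocycle_factor c0; rewrite fE.
  set z := aug _ _; have [m <-] := powquot_pi_surj z.
  have := cpi << m >>; rewrite /= fE => <-; congr (f _).
  by rewrite (@aug_map _ _ _ (powquot_pi a M k)) augU.
move=> /coboundS[g gE].
have [t tP] := torsion_Ext_injective hR Mfg (fg_powquot k Mfg) Gt c0 gE.
exists (maxn k t), (leq_maxl k t); apply/coboundS.
apply: (tP _ (powquot_pi a M (maxn k t))).
- by move=> m; apply: powquot_projE.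
- exact: powquot_pi_surj.
- by move=> m /powquot_pi0; apply: powmod_sub; apply: leq_maxr.
Qed.

Lemma fg_ring : finitely_generated (R^o : lmodType R).
Proof.
exists [:: (1 : R^o)] => r; have -> : r \in full R^o by [].
rewrite -[r]mulr1; apply: (@rpredZ _ R^o _ r (1 : R^o)).
by apply: span_mem; rewrite /= inE.
Qed.

(** Ext^{n+1}(R, G) = 0 because the identity of R factors through a free
    module. *)
Lemma local_cohomology_torsion G n (v : local_cohomology a n.+1 G) :
  torsion a G -> v = 0.
Proof.
move=> Gt; have [k /(_ k (leqnn k))[c cv]] := glc_class_surj v.
apply/(glc_class0 cv)/(glc_kernel_torsion fg_ring Gt (glc_class_cocycle cv)).
apply/coboundS.
have sl : linear (fun x : R^o => (x : R) *: (<< 1 : R^o >> : freem R^o)).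
  by move=> r x y; rewrite scalerDl scalerA.
have [x|y|u uE] := @scale_cobound _ R^o G 1 (mk_linear sl) n
    (c \o res_map (powquot_pi a R^o k) n.+1).
- rewrite -[mk_linear sl x]/((x : R) *: _) linearZ/= augU scale1r.
  exact: mulr1.
- rewrite -[LHS]/(c (res_map (powquot_pi a R^o k) n.+1 (res_diff R^o n.+1 y))).
  rewrite res_map_diff.
  exact: glc_class_cocycle cv _.
- by exists u => y; rewrite -uE scale1r.
Qed.

Lemma length_torsion M G n m : finitely_generated M -> torsion a G ->
  length_le (Ext n M G) m -> length_le (gen_local_cohomology a n M G) m.
Proof.
move=> Mfg Gt; pose Q (v : gen_local_cohomology a n M G) (w : Ext n M G) :=
  exists k, exists2 c : {linear res (powquot a M k) n -> G},
    glc_class c v & ext_class (c \o res_map (powquot_pi a M k) n) w.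
apply: (@length_injective _ _ _ Q).
- move=> r v w v' w' [k [c cv cw]] [l [d dv dw]].
  have [kl lk] := (leq_maxl k l, leq_maxr k l).
  have pE i (ki : (i <= maxn k l)%N) (b : {linear res (powquot a M i) n -> G}) :
      b \o res_map (powquot_pi a M i) n =
      (b \o res_map (powquot_proj a M ki) n) \o
         res_map (powquot_pi a M (maxn k l)) n.
    apply/funext => y /=; rewrite -(@res_map_comp _ _ _ _ _ _ (powquot_pi a M i))//.
    by move=> x; rewrite powquot_projE.
  rewrite (pE _ kl) in cw; rewrite (pE _ lk) in dw.
  exists (maxn k l), ((r \*: (c \o res_map (powquot_proj a M kl) n))
                      \+ (d \o res_map (powquot_proj a M lk) n)).
    exact: (glc_class_linear r (glc_class_proj kl cv) (glc_class_proj lk dv)).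
  exact: (ext_class_linear r cw dw).
- move=> v; have [k /(_ k (leqnn k))[c cv]] := glc_class_surj v.
  have [|w cw] := @ext_class_ex _ n M G (c \o res_map (powquot_pi a M k) n).
    move=> y; rewrite -[LHS]/(c (res_map (powquot_pi a M k) n (res_diff M n y))).
    rewrite res_map_diff.
    exact: glc_class_cocycle cv _.
  by exists w, k, c.
- move=> v [k [c cv /ext_class0 [/(_ erefl) cb _]]].
  exact/(glc_class0 cv)/(glc_kernel_torsion Mfg Gt (glc_class_cocycle cv)).
Qed.

Variables (X E : lmodType R) (e : {linear X -> E}).
Hypothesis eK : forall v, e v = 0 <->
  exists k, forall r, r \in ideal_exp a k -> r *: v = 0.
Hypothesis E_acyclic : forall N k,
  (forall r (v : N), r \in ideal_exp a k -> r *: v = 0) ->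
  forall i (c : {linear res N i -> E}), (forall y, c (res_diff N i y) = 0) ->
  (c : res N i -> E) \in coboundary N E i.

Local Notation G := (subm (ker e)).

Let iG : {linear G -> X} := @subm_val _ _ (ker e).

Lemma ker_torsion : torsion a G.
Proof.
case=> v vK; have /eqP/eK[k kP] := vK; exists k => r ra.
by apply: val_inj; apply: kP.
Qed.

Lemma iG_inj (x : G) : iG x = 0 -> x = 0.
Proof. by move=> x0; apply: val_inj. Qed.

Lemma e_iG (x : G) : e (iG x) = 0.
Proof. by case: x => x xK; apply/eqP. Qed.

Lemma ker_lift U (f : {linear freem U -> X}) : (forall y, e (f y) = 0) ->
  exists g : {linear freem U -> G}, forall y, f y = iG (g y).
Proof.
move=> f0; have [|g gE] := @corestrict _ _ _ f (ker e).
  by move=> y; rewrite unfold_in /ker_pred f0.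
by exists g => y; rewrite -gE.
Qed.

Lemma powquot_acyclic M k i (c : {linear res (powquot a M k) i -> E}) :
  (forall y, c (res_diff _ i y) = 0) ->
  (c : _ -> E) \in coboundary (powquot a M k) E i.
Proof.
apply: (E_acyclic (k := k)) => r q ra; have [m <-] := powquot_pi_surj q.
rewrite -linearZ -(linear0 (powquot_pi a M k)); apply/eqP.
by rewrite quotm_eqE subr0 powmodP.
Qed.

Variables (Z : lmodType R) (p : {linear E -> Z}).
Hypothesis pK : forall y, p y = 0 <-> exists x, e x = y.
Hypothesis p_surj : forall z, exists y, p y = z.

Lemma p_lift U (f : {linear freem U -> Z}) :
  exists g : {linear freem U -> E}, forall y, f y = p (g y).
Proof.
apply: free_lift_exact => u; have [y <-] := p_surj (f << u >>); by exists y.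
Qed.

Lemma e_lift U (f : {linear freem U -> E}) : (forall y, p (f y) = 0) ->
  exists g : {linear freem U -> X}, forall y, f y = e (g y).
Proof.
move=> f0; apply: free_lift_exact => u.
by have /pK[x <-] := f0 << u >>; exists x.
Qed.

Lemma pe x : p (e x) = 0. Proof. by apply/pK; exists x. Qed.

Lemma cobound_mod_e N n (f : {linear res N n -> E}) (u : {linear res N n -> X}) :
    (f \- (e \o u) : res N n -> E) \in coboundary N E n ->
  p \o f \in coboundary N Z n.
Proof.
case: n f u => [|n] f u.
  move=> /cobound0 fu; apply/cobound0 => y.
  have /eqP := fu y; rewrite subr_eq0 => /eqP fuy.
  by rewrite -[LHS]/(p (f y)) fuy pe.
move=> /coboundS[q qE]; apply/coboundS.
by exists (p \o q) => y /=; rewrite -qE linearB /= pe subr0.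
Qed.

(** Subtract from g the coboundary of a lift of q to E, where p \o g is the
    coboundary of q; the result takes its values in e(X). *)
Lemma cobound_p_lift N n (g : {linear res N n -> E}) :
    p \o g \in coboundary N Z n ->
  exists w : {linear res N n -> X}, forall y,
    e (w (res_diff N n y)) = g (res_diff N n y).
Proof.
case: n g => [|n] g pg.
  have [y|w wE] := @e_lift _ g.
    by move/cobound0: pg => /(_ y).
  by exists w => y; rewrite -wE.
have [q qE] := proj1 (coboundS _) pg.
have [q' q'E] := p_lift q.
have [y|w wE] := @e_lift _ (g \- (q' \o res_diff N n)).
  by rewrite /= linearB -q'E -qE subrr.
exists w => y; rewrite -wE.
rewrite -[LHS]/(g _ - q' (res_diff N n (res_diff N n.+1 y))).
by rewrite res_diffK linear0 subr0.
Qed.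

Variable M : lmodType R.

Local Notation C k := (powquot a M k).
Local Notation pr kl := (powquot_proj a M kl).

Definition from_torsion n (v : gen_local_cohomology a n M G)
    (w : gen_local_cohomology a n M X) :=
  exists k, exists2 c : {linear res (C k) n -> G},
    glc_class c v & glc_class (iG \o c) w.

(** The usual recipe: e \o c is the coboundary of g, and p \o g represents the
    image of the class of c. *)
Definition connecting n (v : gen_local_cohomology a n.+1 M X)
    (w : gen_local_cohomology a n M Z) :=
  exists k (c : {linear res (C k) n.+1 -> X}) (g : {linear res (C k) n -> E}),
  [/\ glc_class c v, glc_class (p \o g) w &
      forall y, e (c y) = g (res_diff (C k) n y)].

Lemma from_torsion_linear n : linear_rel (@from_torsion n).
Proof.
move=> r v w v' w' [k [c cv cw]] [l [d dv dw]].
have [kl lk] := (leq_maxl k l, leq_maxr k l).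
exists (maxn k l), ((r \*: (c \o res_map (pr kl) n)) \+ (d \o res_map (pr lk) n)).
  exact: (glc_class_linear r (glc_class_proj kl cv) (glc_class_proj lk dv)).
have := glc_class_linear r (glc_class_proj kl cw) (glc_class_proj lk dw).
suff -> : (fun y => r *: (iG \o c \o res_map (pr kl) n) y +
    (iG \o d \o res_map (pr lk) n) y) = iG \o ((r \*: (c \o res_map (pr kl) n))
    \+ (d \o res_map (pr lk) n) : {linear _ -> _}) by [].
apply/funext => y.
by rewrite -[RHS]/(iG (r *: c (res_map _ n y) + d (res_map _ n y))) linearP.
Qed.

Lemma from_torsion0 n w : @from_torsion n 0 w -> w = 0.
Proof.
move=> [k [c cv cw]].
have [/(_ erefl)[l [kl cb]] _] := glc_class0 cv.
by apply/(glc_class0 cw); exists l, kl; apply: (cobound_comp iG cb).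
Qed.

Lemma from_torsion_surj0 w : exists v, @from_torsion 0 v w.
Proof.
have [k /(_ k (leqnn k))[c cw]] := glc_class_surj w.
have c0 := glc_class_cocycle cw.
have /cobound0 ec0 := @powquot_acyclic M k 0 (e \o c)
  (fun y => etrans (congr1 e (c0 y)) (linear0 e)).
have [g gE] := ker_lift ec0.
have [|v vP] := @glc_class_ex _ a M 0 G k g.
  by move=> y; apply: iG_inj; rewrite -gE c0.
exists v, k, g => //; suff -> : iG \o g = c by [].
by apply/funext => y /=; rewrite gE.
Qed.

Lemma connecting_linear n : linear_rel (@connecting n).
Proof.
move=> r v w v' w' [k [c [g [cv gw cg]]]] [l [d [h [dv hw dh]]]].
have [kl lk] := (leq_maxl k l, leq_maxr k l).
exists (maxn k l),
  ((r \*: (c \o res_map (pr kl) n.+1)) \+ (d \o res_map (pr lk) n.+1)),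
  ((r \*: (g \o res_map (pr kl) n)) \+ (h \o res_map (pr lk) n)); split.
- exact: (glc_class_linear r (glc_class_proj kl cv) (glc_class_proj lk dv)).
- have := glc_class_linear r (glc_class_proj kl gw) (glc_class_proj lk hw).
  suff -> : (fun y => r *: (p \o g \o res_map (pr kl) n) y +
      (p \o h \o res_map (pr lk) n) y) = p \o ((r \*: (g \o res_map (pr kl) n))
      \+ (h \o res_map (pr lk) n) : {linear _ -> _}) by [].
  by apply/funext => y /=; rewrite linearP.
- move=> y.
  rewrite -[LHS]/(e (r *: c (res_map _ n.+1 y) + d (res_map _ n.+1 y))).
  rewrite linearP cg dh -!res_map_diff; exact: erefl.
Qed.

Lemma connecting_total n v : exists w, @connecting n v w.
Proof.
have [k /(_ k (leqnn k))[c cv]] := glc_class_surj v.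
have c0 := glc_class_cocycle cv.
have /coboundS[g gE] := @powquot_acyclic M k n.+1 (e \o c)
  (fun y => etrans (congr1 e (c0 y)) (linear0 e)).
have [|w wP] := @glc_class_ex _ a M n Z k (p \o g).
  by move=> y; rewrite -[LHS]/(p (g (res_diff (C k) n y))) -gE pe.
by exists w, k, c, g.
Qed.

Lemma connecting_proj n k l (kl : (k <= l)%N)
    (c : {linear res (C k) n.+1 -> X}) (g : {linear res (C k) n -> E}) :
    (forall y, e (c y) = g (res_diff (C k) n y)) ->
  forall y, e (c (res_map (pr kl) n.+1 y)) =
    g (res_map (pr kl) n (res_diff (C l) n y)).
Proof. by move=> cg y; rewrite cg res_map_diff. Qed.

Lemma connecting_functional n w : @connecting n 0 w -> w = 0.
Proof.
move=> [k [c [g [cv gw /[dup] cg /connecting_proj cg']]]].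
have [/(_ erefl)[l [kl /coboundS[u uE]]] _] := glc_class0 cv.
apply/(glc_class0 gw); exists l, kl.
have f0 y : ((g \o res_map (pr kl) n) \- (e \o u)) (res_diff (C l) n y) = 0.
  by rewrite /= -cg' -uE subrr.
exact: (cobound_mod_e (powquot_acyclic f0)).
Qed.

(** If p \o g is a coboundary, then c differs from a coboundary by a cocycle with
    values in ker e. *)
Lemma connecting_exact n v :
  @connecting n v 0 -> exists x, @from_torsion n.+1 x v.
Proof.
move=> [k [c [g [cv gw /connecting_proj cg]]]].
have [/(_ erefl)[l [kl pg]] _] := glc_class0 gw.
have [w wE] := @cobound_p_lift (C l) n (g \o res_map (pr kl) n) pg.
have c0 := glc_class_cocycle cv.
have [y|ga gaE] := @ker_lift _
    ((c \o res_map (pr kl) n.+1) \- (w \o res_diff (C l) n)).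
  rewrite -[LHS]/(e (c (res_map (pr kl) n.+1 y) - w (res_diff (C l) n y))).
  by rewrite linearB wE cg subrr.
have [y|x xP] := @glc_class_ex _ a M n.+1 G l ga.
  apply: iG_inj; rewrite -gaE.
  rewrite -[LHS]/(c (res_map _ n.+1 (res_diff (C l) n.+1 y))
                 - w (res_diff (C l) n (res_diff (C l) n.+1 y))).
  by rewrite res_map_diff c0 res_diffK linear0 subr0.
exists x, l, ga => //.
apply: (@glc_class_cohomologous _ _ _ _ _ _ (\- w)) (glc_class_proj kl cv) => y.
by rewrite -[LHS]/(iG (ga y)) -gaE.
Qed.

End ConnectingSequence.

(** * Dimension shift and the length bound *)

Section DimensionShift.
Variables (R : comNzRingType) (hR : noetherian R) (a : submodClosed R^o).
Variables (X E : lmodType R) (e : {linear X -> E}).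
Hypothesis eK : forall v, e v = 0 <->
  exists k, forall r, r \in ideal_exp a k -> r *: v = 0.
Hypothesis E_acyclic : forall (N : lmodType R) k,
  (forall r (v : N), r \in ideal_exp a k -> r *: v = 0) ->
  forall i (c : {linear res N i -> E}), (forall y, c (res_diff N i y) = 0) ->
  (c : res N i -> E) \in coboundary N E i.
Variables (Z : lmodType R) (p : {linear E -> Z}).
Hypothesis pK : forall y, p y = 0 <-> exists x, e x = y.
Hypothesis p_surj : forall z, exists y, p y = z.

Local Notation G := (subm (ker e)).
Local Notation C k := (powquot a R^o k).
Local Notation pr kl := (powquot_proj a R^o kl).

Let Gt : torsion a G := ker_torsion eK.

(** The connecting relation for M = R. Injectivity and surjectivity come from the
    vanishing of H^{n+1}(G) and of H^{n+2}(G): a lift c of the boundary of b' is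
    a cocycle only up to a cocycle with values in G, which has to be made a
    coboundary. *)
Lemma local_cohomology_shift n :
  exists (f : {linear local_cohomology a n.+1 X -> local_cohomology a n Z})
         (g : {linear local_cohomology a n Z -> local_cohomology a n.+1 X}),
    cancel f g /\ cancel g f.
Proof.
apply: (@linear_rel_iso _ _ _ (@connecting _ a _ _ e _ p R^o n)).
- exact: connecting_linear.
- exact: (@connecting_total _ _ _ _ _ E_acyclic _ _ pK R^o n).
- move=> w; have [k /(_ k (leqnn k))[b bw]] := glc_class_surj w.
  have b0 := glc_class_cocycle bw.
  have [b' b'E] := p_lift p_surj b.
  have [y|c cE] := e_lift (f := b' \o res_diff (C k) n) pK.
    by rewrite -[LHS]/(p (b' (res_diff (C k) n y))) -b'E b0.
  have [y|ga gaE] := ker_lift (e := e) (f := c \o res_diff (C k) n.+1).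
    rewrite -[LHS]/(e (c (res_diff (C k) n.+1 y))) -cE.
    rewrite -[LHS]/(b' (res_diff (C k) n (res_diff (C k) n.+1 y))).
    by rewrite res_diffK linear0.
  have {}gaE y : c (res_diff (C k) n.+1 y) = subm_val (ga y) := gaE y.
  have [y|v gv] := @glc_class_ex _ a R^o n.+2 G k ga.
    by apply: iG_inj; rewrite -[LHS]gaE res_diffK linear0.
  have [/(_ (local_cohomology_torsion hR v Gt))[l [kl /coboundS[d dE]]] _] :=
    glc_class0 gv.
  (* c' is still a lift of the boundary of b', and now a cocycle. *)
  pose c' : {linear res (C l) n.+1 -> X} :=
    (c \o res_map (pr kl) n.+1) \- (@subm_val _ _ (ker e) \o d).
  have c'0 y : c' (res_diff (C l) n.+1 y) = 0.
    have gadE : ga (res_map (pr kl) n.+2 y) = d (res_diff (C l) n.+1 y) := dE y.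
    rewrite -[LHS]/(c (res_map (pr kl) n.+1 (res_diff (C l) n.+1 y))
                    - subm_val (d (res_diff (C l) n.+1 y))).
    by rewrite -gadE res_map_diff gaE subrr.
  have [u uc] := glc_class_ex c'0.
  exists u, l, c', (b' \o res_map (pr kl) n); split=> //.
    have := glc_class_proj kl bw.
    suff -> : b \o res_map (pr kl) n = p \o (b' \o res_map (pr kl) n) by [].
    by apply/funext => y /=; rewrite b'E.
  move=> y; rewrite -[LHS]/(e (c (res_map (pr kl) n.+1 y) - subm_val (d y))).
  rewrite linearB e_iG subr0 -cE.
  rewrite -[LHS]/(b' (res_diff (C k) n (res_map (pr kl) n.+1 y))).
  by rewrite -res_map_diff.
- exact: (@connecting_functional _ _ _ _ _ E_acyclic _ _ pK R^o n).
- move=> v /(connecting_exact pK p_surj)[x].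
  by rewrite (local_cohomology_torsion hR x Gt); apply: from_torsion0.
Qed.

(** H^0(X) consists of the elements of X killed by a power of a: a cocycle of
    degree 0 is a linear map R/a^k -> X, determined by the image of 1. *)
Definition value_at1 (v : local_cohomology a 0 X) (g : G) :=
  exists k, exists2 c : {linear res (C k) 0 -> X},
    glc_class c v & c << powquot_pi a R^o k 1 >> = subm_val g.

Lemma local_cohomology0_iso :
  exists (f : {linear local_cohomology a 0 X -> G})
         (g : {linear G -> local_cohomology a 0 X}), cancel f g /\ cancel g f.
Proof.
have val_proj k l (kl : (k <= l)%N) (c : {linear res (C k) 0 -> X}) :
    c (res_map (pr kl) 0 << powquot_pi a R^o l 1 >>) =
    c << powquot_pi a R^o k 1 >>.
  by rewrite /= free_liftU /= powquot_projE.
apply: (@linear_rel_iso _ _ _ value_at1).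
- move=> r v g v' g' [k [c cv cg]] [l [d dv dg]].
  have [kl lk] := (leq_maxl k l, leq_maxr k l).
  exists (maxn k l),
    ((r \*: (c \o res_map (pr kl) 0)) \+ (d \o res_map (pr lk) 0)).
    exact: (glc_class_linear r (glc_class_proj kl cv) (glc_class_proj lk dv)).
  set x := << _ >>.
  rewrite -[LHS]/(r *: c (res_map (pr kl) 0 x) + d (res_map (pr lk) 0 x)).
  by rewrite !val_proj cg dg.
- move=> v; have [k /(_ k (leqnn k))[c cv]] := glc_class_surj v.
  have [f fE] := cocycle_factor (glc_class_cocycle cv).
  have cK : c << powquot_pi a R^o k 1 >> \in ker e.
    apply/eqP/eK; exists k => r ra; rewrite fE augU -!linearZ.
    rewrite -(linear0 f); congr (f _); apply/eqP.
    by rewrite -(linear0 (powquot_pi a R^o k)) quotm_eqE subr0 powmodP.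
  by exists (Subm cK), k, c.
- case=> x xK; have /eqP/eK[k kP] := xK.
  have sl : linear (fun r : R^o => (r : R) *: x).
    by move=> r p1 q; rewrite scalerDl scalerA.
  have [r|f fE] := factor_surj (c := mk_linear sl) (@powquot_pi_surj _ a R^o k).
    move=> /powquot_pi0; move: r; apply: ideal_mul_ind => [r u v u0 v0||r v ra _].
    + by rewrite linearP u0 v0 scaler0 addr0.
    + exact: linear0.
    + rewrite -[LHS]/((r * v) *: x) mulrC -scalerA kP//; exact: scaler0.
  have [|v vP] := @glc_class_ex _ a R^o 0 X k (f \o aug (C k)).
    move=> y; rewrite -[LHS]/(f (aug (C k) (res_diff (C k) 0 y))).
    by rewrite (@aug_res_diff _ (C k) 0) linear0.
  exists v, k, (f \o aug (C k)) => //.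
  rewrite -[LHS]/(f (aug (C k) << powquot_pi a R^o k 1 >>)) augU -fE.
  exact: scale1r.
- move=> g [k [c cv cg]].
  have [/(_ erefl)[l [kl /cobound0 c0]] _] := glc_class0 cv.
  apply: val_inj; rewrite /= -cg -(val_proj _ _ kl).
  exact: c0.
- move=> v [k [c cv cg]].
  have [f fE] := cocycle_factor (glc_class_cocycle cv).
  apply/(glc_class0 cv); exists k, (leqnn k); apply/cobound0 => y.
  rewrite -[LHS]/(c (res_map (pr (leqnn k)) 0 y)) fE.
  have [r <-] := powquot_pi_surj (aug (C k) (res_map (pr (leqnn k)) 0 y)).
  rewrite -[r]mulr1 -[r * 1]/(r *: (1 : R^o)) linearZ linearZ /=.
  by move: cg; rewrite fE augU => ->; rewrite scaler0.
Qed.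

Lemma length_shift (M : lmodType R) n m q :
    finitely_generated M ->
    length_le (Ext n.+1 M G) m ->
    length_le (gen_local_cohomology a n M Z) q ->
  length_le (gen_local_cohomology a n.+1 M X) (m + q).
Proof.
move=> Mfg /(length_torsion hR Mfg Gt) Gl.
apply: length_exact Gl.
- exact: (@from_torsion_linear _ a _ _ e M n.+1).
- exact: (@connecting_linear _ a _ _ e _ p M n).
- exact: from_torsion0.
- exact: (@connecting_total _ _ _ _ _ E_acyclic _ _ pK M n).
- exact: (@connecting_exact _ _ _ _ _ _ _ pK p_surj M n).
Qed.

Lemma length_degree0 (M : lmodType R) m : finitely_generated M ->
  length_le (Ext 0 M G) m -> length_le (gen_local_cohomology a 0 M X) m.
Proof.
move=> Mfg /(length_torsion hR Mfg Gt).
apply: length_surjective.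
- exact: (@from_torsion_linear _ a _ _ e M 0).
- exact: from_torsion0.
- exact: (@from_torsion_surj0 _ _ _ _ _ E_acyclic M).
Qed.

End DimensionShift.

(** The theorem with arbitrary bounds l in place of lengths, which is the form
    that passes through the induction: X is replaced by Z = E/e(X) and l by its
    shift. *)
Lemma length_gen_local_cohomology (R : comNzRingType) (hR : noetherian R)
    (a : submodClosed R^o) (M : lmodType R) (hM : finitely_generated M)
    (n : nat) (X : lmodType R) (l : nat -> nat) :
    (forall i, (i <= n)%N ->
      length_le (Ext (n - i) M (local_cohomology a i X)) (l i)) ->
  length_le (gen_local_cohomology a n M X) (\sum_(0 <= i < n.+1) l i).
Proof.
elim: n X l => [|n IH] X l hl; have [E [e [eK Eac]]] := exists_effacement a hR X;
  have [f [g [fK gK]]] := local_cohomology0_iso eK;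
  have Gl := length_Ext_iso gK (hl 0%N (leq0n _)).
  by rewrite big_nat1; apply: length_degree0 Gl.
have [S SE] : exists S : submodClosed E, forall y, y \in S <-> exists x, e x = y.
  apply: prop_submod => [r _ _ [x <-] [y <-]|]; last by exists 0; apply: linear0.
  by exists (r *: x + y); apply: linearP.
pose p : {linear E -> quotm S} := quotm_pi S.
have pK y : p y = 0 <-> exists x, e x = y.
  rewrite -SE; split=> [/eqP|yS]; [|apply/eqP];
  by rewrite -(linear0 p) quotm_eqE subr0.
have p_surj z : exists y, p y = z by exists (repr z); apply: quotm_reprK.
rewrite big_nat_recl//; apply: (length_shift hR eK Eac pK p_surj hM) => //.
apply: IH => i ni.
have [u [v [uK vK]]] := local_cohomology_shift hR eK Eac pK p_surj i.
exact: length_Ext_iso vK (hl i.+1 ni).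
Qed.

Theorem corollary3p3 (R : comNzRingType) (hR : noetherian R)
    (a : submodClosed R^o) (M : lmodType R) (hM : finitely_generated M)
    (X : lmodType R) (n : nat)
    (hfin : forall i : nat, (i <= n)%N ->
      finite_length (Ext (n - i) M (local_cohomology a i X))) :
  finite_length (gen_local_cohomology a n M X) /\
  (mod_length (gen_local_cohomology a n M X) <=
   \sum_(0 <= i < n.+1) mod_length (Ext (n - i) M (local_cohomology a i X)))%N.
Proof.
apply: finite_length_le; apply: length_gen_local_cohomology => // i ni.
exact: (mod_length_max (hfin i ni)).2.
Qed.
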